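(* Let $f\in L^1(I^2)$. Then $$\sigma^{\bigtriangleup}_{n}f = \frac{1}{n}\sum_{k=0}^{n-1}S_{k,n-k}f\longrightarrow f$$ almost everywhere on $I^2$ as $n\to\infty$.
   Context: $I=[0,1)$, $\mathbb N=\{0,1,2,\dots\}$, and $I^2$ carries Lebesgue measure. Superscripts on points are indices: $x=(x^1,x^2)\in I^2$. For $n\in\mathbb N$ and $x\in I$ write the dyadic expansions $n=\sum_{j\ge 0}n_j2^j$, $x=\sum_{j\ge 0}x_j2^{-j-1}$ with $n_j,x_j\in\{0,1\}$ (for dyadic rational $x$ choose the expansion terminating in zeros). The Walsh-Paley functions on $I$ are $\omega_n(x)=(-1)^{\sum_{j\ge 0}n_jx_j}$, $n\in\mathbb N$. For $f\in L^1(I^2)$ and $i,j\in\mathbb N$ the Fourier coefficients are $\hat f(i,j)=\int_{I^2}f(x)\omega_i(x^1)\omega_j(x^2)\,dx$. The rectangular partial sums are $S_{m,l}f(y)=\sum_{i=0}^{m-1}\sum_{j=0}^{l-1}\hat f(i,j)\omega_i(y^1)\omega_j(y^2)$ ($m,l\in\mathbb N$; empty sums are $0$). The triangular partial sums are $S_k^{\bigtriangleup}f(y)=\sum_{i=0}^{k-1}\sum_{j=0}^{k-i-1}\hat f(i,j)\omega_i(y^1)\omega_j(y^2)$, and the Fejér means of the triangular partial sums are $\sigma_n^{\bigtriangleup}f=\frac1n\sum_{k=0}^{n-1}S_k^{\bigtriangleup}f$ for $n\ge 1$. *)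

(* Defs.v *)
From mathcomp Require Import all_boot all_order all_algebra.
From mathcomp Require Import all_classical all_reals all_analysis.

Set Implicit Arguments.
Unset Strict Implicit.
Unset Printing Implicit Defensive.

Import Order.TTheory GRing.Theory Num.Theory.
Import numFieldNormedType.Exports.

Local Open Scope classical_set_scope.
Local Open Scope ring_scope.

(* Notation rather than definition: the sigma-finite measure structure of the
   product stays visible to type inference. *)
Notation leb2 R :=
  ((@lebesgue_measure R) \x (@lebesgue_measure R))%E (only parsing).

Definition I2 (R : realType) : set (R * R) := `[0, 1[ `*` `[0, 1[.

(* The digit n_j of n = \sum_j n_j 2^j. *)
Definition nat_digit (n j : nat) : bool := odd (n %/ 2 ^ j).

(* The digit x_j of x = \sum_j x_j 2^{-j-1}, meaningful for x in [0, 1[: the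
   parity of the integer part of 2^{j+1} x. For a dyadic rational x this
   selects the expansion terminating in zeros. *)
Definition real_digit (R : realType) (x : R) (j : nat) : bool :=
  odd (Num.truncn (x * 2 ^+ j.+1)).

(* The sum in the exponent stops at j < n because n < 2 ^ n makes all further
   digits n_j vanish. *)
Definition walsh (R : realType) (n : nat) (x : R) : R :=
  (-1) ^+ (\sum_(j < n) nat_digit n j * real_digit x j)%N.

Definition fourier_coef (R : realType) (f : R * R -> R) (i j : nat) : R :=
  \int[leb2 R]_(x in @I2 R) (f x * walsh i x.1 * walsh j x.2).

Definition rect_sum (R : realType) (m l : nat) (f : R * R -> R) (y : R * R)
    : R :=
  \sum_(i < m) \sum_(j < l) fourier_coef f i j * walsh i y.1 * walsh j y.2.

Definition triang_sum (R : realType) (k : nat) (f : R * R -> R) (y : R * R)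
    : R :=
  \sum_(i < k) \sum_(j < k - i) fourier_coef f i j * walsh i y.1 * walsh j y.2.

Definition triang_fejer (R : realType) (n : nat) (f : R * R -> R) (y : R * R)
    : R :=
  n%:R^-1 * \sum_(k < n) triang_sum k f y.

(* Main.v *)
(* Write w_n for the Walsh functions. With z a formal variable and m = 2^j,
     \sum_n (\sum_{i+j=n} w_i(x) w_j(y)) z^n =
       \prod_j (1 + r_j z^m) (1 + s_j z^m),   r_j = (-1)^{x_j}, s_j = (-1)^{y_j},
   and the triangular partial sums and the numerators of the Fejer kernels are
   obtained from these coefficients by one and two summations, i.e. by
   multiplying the series with z / (1 - z) once and twice. Removing the first
   digit pair replaces z by z^2, and the summations absorb one or two factors
   1 - z whenever a digit is nonzero. This bounds the numerator L_n(x,y), for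
   (x,y) outside the dyadic square Q_A at 0 and uniformly in n, by a product of
   digitwise factors whose mean over J digits is at most
   C 8^A theta^(J - A) 4^(-J) with theta < 8. The gain over the trivial bound
   with theta = 8 comes from the unsummed coefficients, for which two
   consecutive mixed digit pairs, r_j <> s_j, cost a factor 2 instead of 4. Summing over the dyadic
   blocks 2^N < n <= 2^(N+1) with N >= A gives
     sup_A \int_{Q_A^c} sup_{n > 2^A} |L_n| / n < oo,
   so a Calderon-Zygmund decomposition shows that the maximal operator is of
   weak type (1,1). For n <= 2^M everything only depends on the first M digits,
   hence the maximal inequality is proved on finite sets of digit sequences and
   transferred by a monotone limit in M. Dyadic step functions are dense in L^1
   and for them the convergence is elementary. *)
Require Import Defs.
From mathcomp Require Import all_boot all_order all_algebra.
From mathcomp Require Import all_classical all_reals all_analysis.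
From mathcomp Require Import measurable_realfun ring lra zify.

Set Implicit Arguments.
Unset Strict Implicit.
Unset Printing Implicit Defensive.

Import Order.TTheory GRing.Theory Num.Theory.
Import numFieldNormedType.Exports.
Import HBSimple.

Local Open Scope ring_scope.

(** * Digit recursions for the kernels *)

Section Kernels.
Variable R : realFieldType.
Implicit Types (b : bool) (s : seq bool) (u : seq (bool * bool)).

Definition digit_sign b : R := (-1) ^+ b.

(** The generating polynomial of the Walsh functions at a point with digits [s], i.e. the product of
    the 1 + r_j z^(2^j); substituting z^2 moves the remaining digits up by one position. *)
Fixpoint wpoly s : {poly R} :=
  if s is b :: s' then (1 + digit_sign b *: 'X) * (wpoly s' \Po 'X^2) else 1.

(* Only the digits in s enter, so wal s i is the Walsh function w_i for
   i < 2 ^ size s and vanishes for larger i. *)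
Definition wal s i : R := (wpoly s)`_i.

(** Serves a single digit (c = 0) and a digit pair (a = r + s, c = r s) alike. Since [0.-1] is 0,
    the term shifted by z^2 has to be removed by hand at index 0. *)
Lemma coef_double_mul (p : {poly R}) (a c : R) i :
  ((1 + a *: 'X + c *: 'X^2) * (p \Po 'X^2))`_i =
  if odd i then a * p`_i./2 else p`_i./2 + c * (if i is 0 then 0 else p`_(i./2).-1).
Proof.
have comp k : (p \Po 'X^2)`_k = if odd k then 0 else p`_k./2.
  rewrite coef_comp_poly_Xn // dvdn2 divn2.
  by case: (odd k).
rewrite !mulrDl mul1r -!scalerAl !coefD !coefZ coefXM coefXnM !comp.
case: i => [|[|i]] /=; rewrite ?mulr0 ?addr0 ?add0r ?negbK //.
rewrite subSS subSS subn0.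
by case E: (odd i) => /=; rewrite ?uphalf_half ?E ?mulr0 ?addr0 ?add0r ?mulr1.
Qed.

Lemma wal_nil i : wal [::] i = (i == 0%N)%:R.
Proof. by rewrite /wal coef1. Qed.

Lemma wal_cons b s i : wal (b :: s) i = (-1) ^+ (odd i && b) * wal s i./2.
Proof.
have := coef_double_mul (wpoly s) (digit_sign b) 0 i.
rewrite scale0r addr0 mul0r addr0 /wal /= => ->.
by rewrite /digit_sign; case: (odd i); rewrite ?mul1r.
Qed.

(** The kernels at a point with digit pairs [u]: the antidiagonal i + j = m, the triangular partial
    sum, and n times the Fejer kernel, as [fejer_ker] is not divided by n. *)
Definition diag_sum u m : R := (wpoly (unzip1 u) * wpoly (unzip2 u))`_m.
Definition tri_sum u n : R := \sum_(m < n) diag_sum u m.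
Definition fejer_ker u n : R := \sum_(m < n) tri_sum u m.

Lemma diag_sum_nil m : diag_sum [::] m = (m == 0%N)%:R.
Proof. by rewrite /diag_sum mulr1 coef1. Qed.

Lemma diag_sum_cons b c u n :
  diag_sum ((b, c) :: u) n =
  if odd n then (digit_sign b + digit_sign c) * diag_sum u n./2
  else diag_sum u n./2 + digit_sign b * digit_sign c * (if n is 0 then 0 else diag_sum u (n./2).-1).
Proof.
rewrite /diag_sum /= -coef_double_mul rmorphM /=; congr (_`__).
have -> : 1 + (digit_sign b + digit_sign c) *: 'X + (digit_sign b * digit_sign c) *: 'X^2 =
    (1 + digit_sign b *: 'X) * (1 + digit_sign c *: 'X) :> {poly R}.
  by rewrite -!mul_polyC polyCD polyCM; ring.
by rewrite mulrACA.
Qed.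

Lemma tri_sum0 u : tri_sum u 0 = 0. Proof. by rewrite /tri_sum big_ord0. Qed.

Lemma tri_sumS u n : tri_sum u n.+1 = tri_sum u n + diag_sum u n.
Proof. by rewrite /tri_sum big_ord_recr. Qed.

Lemma fejer_ker0 u : fejer_ker u 0 = 0.
Proof. by rewrite /fejer_ker big_ord0. Qed.

Lemma fejer_kerS u n : fejer_ker u n.+1 = fejer_ker u n + tri_sum u n.
Proof. by rewrite /fejer_ker big_ord_recr. Qed.

Lemma diag_sum_cons0 b c u : diag_sum ((b, c) :: u) 0 = diag_sum u 0.
Proof. by rewrite diag_sum_cons mulr0 addr0. Qed.

Lemma diag_sum_cons_odd b c u k :
  diag_sum ((b, c) :: u) k.*2.+1 = (digit_sign b + digit_sign c) * diag_sum u k.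
Proof. by rewrite diag_sum_cons /= odd_double /= uphalf_double. Qed.

Lemma diag_sum_cons_even b c u k :
  diag_sum ((b, c) :: u) k.*2.+2 = diag_sum u k.+1 + digit_sign b * digit_sign c * diag_sum u k.
Proof. by rewrite diag_sum_cons /= odd_double /= half_double. Qed.

Definition diag_sumE :=
  (diag_sum_cons0, diag_sum_cons_odd, diag_sum_cons_even).

(** The split into 0, 2k + 1 and 2k + 2 keeps predecessors out of the recursions below. *)
Lemma odd_even_split (P : nat -> Prop) :
  P 0%N -> (forall k, P k.*2.+1 /\ P k.*2.+2) -> forall n, P n.
Proof.
move=> P0 P12 n; rewrite -(odd_double_half n).
case: (odd n) => /=; first by rewrite add1n; case: (P12 n./2).
by rewrite add0n; case: (n./2) => [|k] //; case: (P12 k).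
Qed.

(* The suffixes pp, mm and mixed refer to the signs (r, s) of the digit pair that
   is removed. With primes for the series of the remaining digits,
     T(z) = (1 + z) (1 + r z) (1 + s z) T'(z^2) / z,
     L(z) = (1 + z)^2 (1 + r z) (1 + s z) L'(z^2) / z^2,
   where 1 - z^2 turns L' into T' and T' into E' (up to the power of z). *)
Lemma tri_sum_pp u k :
  tri_sum ((false, false) :: u) k.*2.+1 = tri_sum u k.+1 + 3 * tri_sum u k /\
  tri_sum ((false, false) :: u) k.*2.+2 = 3 * tri_sum u k.+1 + tri_sum u k.
Proof.
elim: k => [|k [IH1 IH2]].
  rewrite !(tri_sumS, tri_sum0) (diag_sum_cons_odd _ _ _ 0) diag_sum_cons0.
  by rewrite /digit_sign; split; ring.
rewrite doubleS (tri_sumS _ k.*2.+3) (tri_sumS _ k.*2.+2) IH2.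
rewrite -doubleS !diag_sumE !tri_sumS /digit_sign; split; ring.
Qed.

Lemma tri_sum_mm u k :
  tri_sum ((true, true) :: u) k.*2.+1 = diag_sum u k /\
  tri_sum ((true, true) :: u) k.*2.+2 = - diag_sum u k.
Proof.
elim: k => [|k [IH1 IH2]].
  rewrite !(tri_sumS, tri_sum0) (diag_sum_cons_odd _ _ _ 0) diag_sum_cons0.
  by rewrite /digit_sign; split; ring.
rewrite doubleS (tri_sumS _ k.*2.+3) (tri_sumS _ k.*2.+2) IH2.
rewrite -doubleS !diag_sumE /digit_sign; split; ring.
Qed.

Lemma tri_sum_mixed b u k :
  tri_sum ((b, ~~ b) :: u) k.*2.+1 = diag_sum u k /\
  tri_sum ((b, ~~ b) :: u) k.*2.+2 = diag_sum u k.
Proof.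
elim: k => [|k [IH1 IH2]].
  rewrite !(tri_sumS, tri_sum0) (diag_sum_cons_odd _ _ _ 0) diag_sum_cons0.
  by rewrite /digit_sign; case: b => /=; split; ring.
rewrite doubleS (tri_sumS _ k.*2.+3) (tri_sumS _ k.*2.+2) IH2.
rewrite -doubleS !diag_sumE /digit_sign; case: b {IH1 IH2} => /=; split; ring.
Qed.

(** The weights 4, 4 and 1, 6, 1 are the binomial coefficients of (1 + z)^4 sorted by parity; either
    group has sum 8, the trivial factor per digit pair. *)
Lemma fejer_ker_pp u k :
  fejer_ker ((false, false) :: u) k.*2.+1 =
    4 * fejer_ker u k.+1 + 4 * fejer_ker u k /\
  fejer_ker ((false, false) :: u) k.*2.+2 =
    fejer_ker u k.+2 + 6 * fejer_ker u k.+1 + fejer_ker u k.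
Proof.
elim: k => [|k [IH1 IH2]].
  have [E1 _] := tri_sum_pp u 0.
  rewrite !(fejer_kerS, fejer_ker0) E1 !tri_sum0.
  by split; ring.
have [_ E2] := tri_sum_pp u k; have [E3 _] := tri_sum_pp u k.+1.
rewrite (fejer_kerS _ k.+1.*2.+1) E3 doubleS (fejer_kerS _ k.*2.+2) IH2 E2.
rewrite !fejer_kerS !tri_sumS; split; ring.
Qed.

(** The prefactor is (1 - z^2)^2, which undoes both summations at once and leaves even indices
    only. *)
Lemma fejer_ker_mm u k :
  fejer_ker ((true, true) :: u) k.*2.+1 = 0 /\
  fejer_ker ((true, true) :: u) k.*2.+2 = diag_sum u k.
Proof.
elim: k => [|k [IH1 IH2]].
  have [E1 _] := tri_sum_mm u 0.
  rewrite !(fejer_kerS, fejer_ker0) E1 !tri_sum0.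
  by split; ring.
have [_ E2] := tri_sum_mm u k; have [E3 _] := tri_sum_mm u k.+1.
rewrite (fejer_kerS _ k.+1.*2.+1) E3 doubleS (fejer_kerS _ k.*2.+2) IH2 E2.
split; ring.
Qed.

Lemma fejer_ker_mixed b u k :
  fejer_ker ((b, ~~ b) :: u) k.*2.+1 = 2 * tri_sum u k /\
  fejer_ker ((b, ~~ b) :: u) k.*2.+2 = tri_sum u k.+1 + tri_sum u k.
Proof.
elim: k => [|k [IH1 IH2]].
  have [E1 _] := tri_sum_mixed b u 0.
  rewrite !(fejer_kerS, fejer_ker0) E1 !tri_sumS !tri_sum0.
  by split; ring.
have [_ E2] := tri_sum_mixed b u k; have [E3 _] := tri_sum_mixed b u k.+1.
rewrite (fejer_kerS _ k.+1.*2.+1) E3 doubleS (fejer_kerS _ k.*2.+2) IH2 E2.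
rewrite !tri_sumS; split; ring.
Qed.

Definition mixed (d : bool * bool) := d.1 != d.2.

(* Each digit pair costs at most a factor 2, but after two mixed pairs
   (1 - z^2) (1 - z^4) E''(z^4) the shifted copies of E'' do not overlap more
   than twice. *)
Fixpoint diag_bound u : R :=
  match u with
  | [::] => 1
  | [:: _] => 2
  | d :: e :: u' => (if mixed d && mixed e then 2 else 4) * diag_bound u'
  end.

(** A pair (0,0) multiplies by (1 + z)^3, whose weights 1, 3 and 3, 1 have sum 4. Any other pair
    absorbs the summation, and from there on the unsummed bound applies. *)
Fixpoint tri_bound u : R :=
  match u with
  | [::] => 1
  | d :: u' => if d == (false, false) then 4 * tri_bound u' else diag_bound u'
  end.

(* A bound only off the dyadic square at 0 of level A, see fejer_ker_le; there the
   recursion never reaches the junk value 0. *)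
Fixpoint fejer_bound A u : R :=
  match A, u with
  | A'.+1, d :: u' =>
      if mixed d then 2 * tri_bound u' else
      if d.1 then diag_bound u' else 8 * fejer_bound A' u'
  | _, _ => 0
  end.

Lemma diag_sum_le2 d u (B : R) :
  (forall k, `|diag_sum u k| <= B) -> forall k, `|diag_sum (d :: u) k| <= 2 * B.
Proof.
move=> uB; case: d => b c; apply: odd_even_split => [|k].
  rewrite diag_sum_cons0; have := uB 0%N; have := normr_ge0 (diag_sum u 0); lra.
rewrite !diag_sumE; have := uB k; have := uB k.+1.
rewrite /digit_sign !ler_norml => /andP[? ?] /andP[? ?].
by case: b; case: c => /=; split; apply/andP; split; lra.
Qed.

Lemma diag_sum_mixed2 d e u (B : R) : mixed d -> mixed e ->
  (forall k, `|diag_sum u k| <= B) -> forall k, `|diag_sum [:: d, e & u] k| <= 2 * B.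
Proof.
case: d e => [b c] [b' c']; rewrite /mixed /= => bc bc' uB.
have v2 k : `|diag_sum ((b', c') :: u) k| <= 2 * B by apply: diag_sum_le2.
have v1 k : diag_sum ((b', c') :: u) k.*2.+1 = 0.
  by rewrite diag_sumE /digit_sign; case: b' c' bc' {v2} => [] [] //= _; ring.
have sbc : digit_sign b + digit_sign c = 0 :> R by rewrite /digit_sign; case: b c bc => [] [] //= _; ring.
have sbc' : digit_sign b * digit_sign c = -1 :> R by rewrite /digit_sign; case: b c bc {sbc} => [] [] //= _; ring.
apply: odd_even_split => [|k]; first by rewrite diag_sum_cons0.
rewrite !diag_sumE sbc sbc' mul0r normr0; split.
  by apply: le_trans (v2 0%N); rewrite normr_ge0.
(* Of the inner coefficients with indices k and k + 1, the one of odd index vanishes by [v1], so a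
   single term is left. *)
rewrite -(odd_double_half k); case: (odd k) => /=.
  by rewrite add1n v1 mulr0 addr0.
by rewrite add0n v1 add0r mulN1r normrN.
Qed.

Lemma diag_sum_le u k : `|diag_sum u k| <= diag_bound u.
Proof.
have [n] := ubnP (size u); elim: n u k => // n IH [|d [|e u]] k sz /=.
- by rewrite diag_sum_nil; case: (k == 0%N); rewrite ?normr1 ?normr0.
- rewrite -[2]mulr1; apply: diag_sum_le2 => j.
  by rewrite diag_sum_nil; case: (j == 0%N); rewrite ?normr1 ?normr0.
have uB j : `|diag_sum u j| <= diag_bound u by apply: IH; move: sz => /=; lia.
case: ifP => [/andP[md me]|_]; first exact: diag_sum_mixed2.
rewrite (_ : 4 * _ = 2 * (2 * diag_bound u)); last by ring.
by do 2 apply: diag_sum_le2 => ?.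
Qed.

Lemma diag_bound_ge0 u : 0 <= diag_bound u.
Proof. exact: le_trans (normr_ge0 _) (diag_sum_le u 0). Qed.

Lemma tri_sum_le u n : `|tri_sum u n| <= tri_bound u.
Proof.
elim: u n => [|[b c] u IH] n /=.
  rewrite /tri_sum; under eq_bigr do rewrite diag_sum_nil.
  by case: n => [|n]; rewrite ?big_ord0 ?normr0 // big_ord_recl big1 ?addr0 ?normr1.
have H0 : `|tri_sum ((b, c) :: u) 0| <= diag_bound u.
  by rewrite tri_sum0 normr0 diag_bound_ge0.
have Hk := diag_sum_le u.
case: b c H0 => [] [] /= H0; move: n;
  apply: odd_even_split => [|k] //.
- by have [-> ->] := tri_sum_mm u k; rewrite normrN.
- by have [-> ->] := tri_sum_mixed true u k.
- by have [-> ->] := tri_sum_mixed false u k.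
- rewrite tri_sum0 normr0; apply: mulr_ge0 => //.
  exact: le_trans (normr_ge0 _) (IH 0%N).
- have [-> ->] := tri_sum_pp u k; have := IH k; have := IH k.+1.
  rewrite !ler_norml => /andP[? ?] /andP[? ?].
  by split; apply/andP; split; lra.
Qed.

Lemma tri_bound_ge0 u : 0 <= tri_bound u.
Proof. exact: le_trans (normr_ge0 _) (tri_sum_le u 0). Qed.

Lemma fejer_bound_ge0 A u : 0 <= fejer_bound A u.
Proof.
elim: A u => [|A IH] [|d u] //=.
by case: ifP => _; [|case: ifP => _]; rewrite ?mulr_ge0 ?tri_bound_ge0 ?diag_bound_ge0.
Qed.

(** The hypothesis on [take A u] yields a pair other than (0,0) among the first [A]. Each (0,0)
    before it costs 8; at that pair one or both summations disappear and [tri_bound] or [diag_bound]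
    takes over. *)
Lemma fejer_ker_le A u n : (A <= size u)%N ->
  take A u != nseq A (false, false) -> `|fejer_ker u n| <= fejer_bound A u.
Proof.
elim: A u n => [|A IH] [|[b c] u] n //= Au; rewrite eqseq_cons.
have H0 : `|fejer_ker ((b, c) :: u) 0| <= 0 by rewrite fejer_ker0 normr0.
have Hk := diag_sum_le u; have Ht := tri_sum_le u.
case: b c H0 => [] [] /= H0 uA; rewrite /mixed /=; move: n;
  apply: odd_even_split => [|k].
- exact: le_trans (diag_bound_ge0 u).
- by have [-> ->] := fejer_ker_mm u k; rewrite normr0 diag_bound_ge0.
- by apply: le_trans H0 _; rewrite mulr_ge0 ?tri_bound_ge0.
- have [-> ->] := fejer_ker_mixed true u k; have := Ht k; have := Ht k.+1.
  rewrite !ler_norml => /andP[? ?] /andP[? ?].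
  by split; apply/andP; split; lra.
- by apply: le_trans H0 _; rewrite mulr_ge0 ?tri_bound_ge0.
- have [-> ->] := fejer_ker_mixed false u k; have := Ht k; have := Ht k.+1.
  rewrite !ler_norml => /andP[? ?] /andP[? ?].
  by split; apply/andP; split; lra.
- by apply: le_trans H0 _; rewrite mulr_ge0 ?fejer_bound_ge0.
- have [-> ->] := fejer_ker_pp u k.
  have IHk j := IH u j Au uA; have := IHk k; have := IHk k.+1; have := IHk k.+2.
  rewrite !ler_norml => /andP[? ?] /andP[? ?] /andP[? ?].
  by split; apply/andP; split; lra.
Qed.

End Kernels.

(** * Averages of the kernel bounds *)

Lemma sum_tupleS (T : finType) (V : nmodType) n (F : n.+1.-tuple T -> V) :
  \sum_t F t = \sum_x \sum_(t : n.-tuple T) F [tuple of x :: t].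
Proof.
rewrite pair_big /=.
rewrite (reindex (fun p : T * n.-tuple T => [tuple of p.1 :: p.2])) //=.
exists (fun t => (thead t, [tuple of behead t])) => [[x t] _|t _] /=.
  by rewrite theadE; congr (_, _); apply: val_inj.
by rewrite -tuple_eta.
Qed.

Section TupleSums.
Variable R : realFieldType.
Implicit Types (u v w : seq (bool * bool)).
Local Notation cell M := (M.-tuple (bool * bool)).

Lemma sum_digits (F : bool * bool -> R) :
  \sum_d F d = F (false, false) + F (true, true) + F (false, true) + F (true, false).
Proof.
rewrite (eq_bigr (fun d => F (d.1, d.2))); last by case.
rewrite -(pair_big xpredT xpredT (fun a b => F (a, b))) /= !big_bool /=; ring.
Qed.

Lemma sum_tuple0 (F : seq (bool * bool) -> R) : \sum_(t : cell 0) F t = F [::].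
Proof.
rewrite (eq_bigr (fun=> F [::])) => [|t _]; last by rewrite tuple0.
by rewrite sumr_const card_tuple expn0 mulr1n.
Qed.

Lemma sum_take (J M : nat) (F : seq (bool * bool) -> R) : (J <= M)%N ->
  \sum_(w : cell M) F (take J w) = 4 ^+ (M - J) * \sum_(t : cell J) F t.
Proof.
elim: J M F => [|J IH] [|M] F // JM.
- by rewrite sum_tuple0 subnn expr0 mul1r; exact: (sum_tuple0 (fun t => F (take 0 t))).
- rewrite sum_tuple0 (eq_bigr (fun=> F [::])) => [|w _]; last by rewrite take0.
  by rewrite sumr_const card_tuple card_prod card_bool -(mulr_natl (F [::])) natrX.
rewrite (@sum_tupleS _ R M).
rewrite !sum_tupleS mulr_sumr; apply: eq_bigr => d _ /=.
exact: (IH M (fun u => F (d :: u))).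
Qed.

Lemma card_prefix (A M : nat) (v : cell M) : (A <= M)%N ->
  \sum_(w : cell M | take A w == take A v) 1 = 4 ^+ (M - A) :> R.
Proof.
move=> AM; rewrite big_mkcond /=.
rewrite (sum_take (fun t => if t == take A v then 1 else 0)) //.
have sz : size (take A v) == A by rewrite size_takel ?size_tuple.
rewrite (bigD1 (Tuple sz)) //= eqxx big1 ?addr0 ?mulr1 // => t.
by rewrite -val_eqE /= => /negbTE ->.
Qed.

(* Any number with 56 <= theta ^ 2 and theta < 8 would do: two digit pairs have
   4 * 2 + 12 * 4 = 56 as the sum of their factors in diag_bound. *)
Definition theta : R := 15 / 2.

(** Induction in steps of two pairs. The constant 2 makes room for a lone pair, where the sum is 4 *
    2 = 8 > [theta]. *)
Lemma sum_diag_bound J :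
  \sum_(t : cell J) diag_bound R t <= 2 * theta ^+ J.
Proof.
have [n] := ubnP J; elim: n J => // n IH [|[|J]] JN.
- by rewrite sum_tuple0 /= expr0; lra.
- have -> : \sum_(t : cell 1) diag_bound R t = \sum_d diag_bound R [:: d].
    rewrite sum_tupleS; apply: eq_bigr => d _.
    exact: (sum_tuple0 (fun t => diag_bound R (d :: t))).
  by rewrite sum_digits /= /theta expr1; lra.
have {}IH := IH J ltac:(lia).
rewrite sum_tupleS sum_digits !sum_tupleS !sum_digits /= -!mulr_sumr !exprS /theta.
have : 0 <= \sum_(t : cell J) diag_bound R t.
  by apply: sumr_ge0 => t _; apply: diag_bound_ge0.
move: IH; rewrite /theta; lra.
Qed.

(** The pair (0,0) contributes the factor 4 and the other three contribute 1 each, and 4 + 3 = 7 <=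
    [theta]. *)
Lemma sum_tri_bound J : \sum_(t : cell J) tri_bound R t <= 2 * theta ^+ J.
Proof.
elim: J => [|J IH]; first by rewrite sum_tuple0 /= expr0; lra.
rewrite sum_tupleS sum_digits /= -!mulr_sumr !exprS /theta.
have : 0 <= theta ^+ J by rewrite exprn_ge0 // /theta; lra.
have := sum_diag_bound J; move: IH; rewrite /theta; lra.
Qed.

(** One more pair gives 8 times the previous sum plus at most 10 theta^J from the nonzero pairs. As
    20 (8 - theta) = 10, the subtracted term closes the induction. *)
Lemma sum_fejer_bound A J : (A <= J)%N ->
  \sum_(t : cell J) fejer_bound R A t <=
  20 * (8 ^+ A * theta ^+ (J - A) - theta ^+ J).
Proof.
elim: A J => [|A IH] J AJ.
  by rewrite big1 //= expr0 mul1r subn0 subrr mulr0.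
case: J AJ => // J AJ.
rewrite sum_tupleS sum_digits /= -!mulr_sumr subSS !exprS /theta.
have := sum_diag_bound J; have := sum_tri_bound J.
have := IH J AJ; rewrite /theta; lra.
Qed.

(** A majorant, independent of n, of |L_n| / n for 2^A < n <= 2^M off the cell of level [A] at 0.
    The supremum over the blocks 2^N < n <= 2^(N+1) is replaced by a sum; on each block the first N
    + 1 digits suffice. *)
Definition tail_bound A M w : R :=
  \sum_(A <= N < M) (2 ^+ N)^-1 * fejer_bound R A (take N.+1 w).

Lemma tail_bound_ge0 A M w : 0 <= tail_bound A M w.
Proof.
apply: sumr_ge0 => N _; apply: mulr_ge0; last exact: fejer_bound_ge0.
by rewrite invr_ge0 exprn_ge0.
Qed.

Lemma sum_tail_bound : exists2 C : R, 0 <= C & forall A M, (A <= M)%N ->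
  \sum_(w : cell M) tail_bound A M w <= C * 4 ^+ M.
Proof.
exists (40 * 15) => [|A M AM]; first by rewrite mulr_ge0.
rewrite exchange_big /=.
(* The ratio is theta / 8, and the powers of 15/16 with positive exponents add up to 15. *)
have geo : \sum_(A <= N < M) (15 / 16 : R) ^+ (N.+1 - A) <= 15.
  rewrite -{1}(add0n A) big_addn.
  have -> : \sum_(0 <= i < M - A) (15 / 16 : R) ^+ ((i + A).+1 - A) =
      15 - 15 * (15 / 16) ^+ (M - A).
    elim: (M - A)%N => [|k IH]; first by rewrite big_geq // expr0; lra.
    by rewrite big_nat_recr //= IH -addSn addnK exprS; lra.
  by rewrite gerBl mulr_ge0 ?exprn_ge0 //; lra.
rewrite (@le_trans _ _ (\sum_(A <= N < M) (40 * 4 ^+ M) * (15 / 16 : R) ^+ (N.+1 - A))) //; last first.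
  rewrite -mulr_sumr (_ : 40 * 15 * 4 ^+ M = 40 * 4 ^+ M * 15); last by ring.
  by rewrite ler_wpM2l // mulr_ge0 ?exprn_ge0.
rewrite !big_seq; apply: ler_sum => N; rewrite mem_index_iota => /andP[AN NM].
rewrite -mulr_sumr sum_take //.
have := @sum_fejer_bound A N.+1 (leqW AN).
move: (\sum_(t : cell N.+1) _) => S Sle.
have S2 : S <= 20 * (8 ^+ A * theta ^+ (N.+1 - A)).
  apply: le_trans Sle _; rewrite ler_wpM2l // gerBl.
  by rewrite exprn_ge0 // /theta; lra.
(* The identity 8^A / 2^N = 2 * 4^(N+1) / 8^(N+1-A) turns the factor 20 of [sum_fejer_bound] into
   40. *)
have -> : 40 * 4 ^+ M * (15 / 16) ^+ (N.+1 - A) =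
    (2 ^+ N)^-1 * (4 ^+ (M - N.+1) * (20 * (8 ^+ A * theta ^+ (N.+1 - A)))).
  have -> : (15 / 16 : R) = theta / 8 by rewrite /theta; lra.
  rewrite expr_div_n.
  have -> : (4 : R) ^+ M = 4 ^+ (M - N.+1) * 4 ^+ N.+1 by rewrite -exprD subnK.
  have e8 : (8 : R) ^+ A * 8 ^+ (N.+1 - A) = 2 ^+ N.+1 * 4 ^+ N.+1.
    by rewrite -exprD subnKC ?leqW // -exprMn; congr (_ ^+ _); ring.
  have n8 : (8 : R) ^+ (N.+1 - A) != 0 by rewrite expf_neq0 // pnatr_eq0.
  have n2 : (2 : R) ^+ N != 0 by rewrite expf_neq0 // pnatr_eq0.
  have -> : (8 : R) ^+ A = 2 * 2 ^+ N * 4 ^+ N.+1 / 8 ^+ (N.+1 - A).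
    by apply: (mulIf n8); rewrite divfK // e8 (exprS 2).
  by field; rewrite n2 n8.
by rewrite ler_wpM2l ?invr_ge0 ?exprn_ge0 // ler_wpM2l ?exprn_ge0.
Qed.

End TupleSums.

Definition xor_digit (p : (bool * bool) * (bool * bool)) :=
  (p.1.1 (+) p.2.1, p.1.2 (+) p.2.2).

(** Addition in the dyadic group, truncated to [M] digits. The Walsh functions are characters for
    it, see [wal_xor], which makes the Fejer means convolutions. *)
Definition xor_cell M (u v : M.-tuple (bool * bool)) : M.-tuple (bool * bool) :=
  [tuple of map xor_digit (zip u v)].

(** * Fejer kernels on finite digit sequences *)

Section Kernel.
Variable R : realFieldType.
Implicit Types (s : seq bool) (u v w : seq (bool * bool)).
Local Notation cell M := (M.-tuple (bool * bool)).

Lemma wal0 s : wal R s 0 = 1.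
Proof. by elim: s => [|b s IH]; rewrite ?wal_nil // wal_cons /= IH mulr1. Qed.

Lemma wal_take J s i : (i < 2 ^ J)%N -> wal R (take J s) i = wal R s i.
Proof.
elim: J s i => [|J IH] [|b s] i //= iJ.
  by move: iJ; rewrite expn0 ltnS leqn0 => /eqP ->; rewrite !wal0.
by rewrite !wal_cons IH //; move: iJ; rewrite expnS; lia.
Qed.

Lemma normr_wal s i : `|wal R s i| <= 1.
Proof.
elim: s i => [|b s IH] i; first by rewrite wal_nil; case: (i == 0%N); rewrite ?normr1 ?normr0.
by rewrite wal_cons normrM normrX normrN1 expr1n mul1r.
Qed.

Lemma diag_sumP u m : diag_sum R u m =
  \sum_(i < m.+1) wal R (unzip1 u) i * wal R (unzip2 u) (m - i).
Proof. by rewrite /diag_sum coefM. Qed.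

Lemma tri_sumP u n : tri_sum R u n =
  \sum_(i < n) \sum_(j < n - i) wal R (unzip1 u) i * wal R (unzip2 u) j.
Proof.
elim: n => [|n IH]; first by rewrite tri_sum0 big_ord0.
rewrite tri_sumS IH diag_sumP.
have -> : \sum_(i < n) \sum_(j < n - i) wal R (unzip1 u) i * wal R (unzip2 u) j =
    \sum_(i < n.+1) \sum_(j < n - i) wal R (unzip1 u) i * wal R (unzip2 u) j.
  by rewrite big_ord_recr /= subnn big_ord0 addr0.
rewrite -big_split /=; apply: eq_bigr => i _.
by rewrite subSn -1?ltnS // big_ord_recr.
Qed.

Lemma fejer_ker_take J u n : (n <= 2 ^ J)%N ->
  fejer_ker R (take J u) n = fejer_ker R u n.
Proof.
move=> nJ; apply: eq_bigr => k _; apply: eq_bigr => m _.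
rewrite !diag_sumP; apply: eq_bigr => i _.
have ? := ltn_ord k; have ? := ltn_ord m; have ? := ltn_ord i.
by rewrite /unzip1 /unzip2 !map_take !wal_take //; lia.
Qed.

(** Three nested sums of at most n terms of modulus at most 1. This suffices on the cell of level A
    at 0 when 2^A < n <= 2^(A+1): its proportion 4^(-A) balances n^2 <= 4 * 4^A. *)
Lemma fejer_ker_le_cube u n : `|fejer_ker R u n| <= n%:R ^+ 3.
Proof.
have bnd (F : nat -> R) (B : R) : (forall k, (k < n)%N -> `|F k| <= B) ->
    forall k, (k <= n)%N -> `|\sum_(i < k) F i| <= n%:R * B.
  move=> FB k kn; apply: le_trans (ler_norm_sum _ _ _) _.
  case: k kn => [|k] kn.
    by rewrite big_ord0; case: n FB kn => [|n'] FB _;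
      rewrite ?mul0r // mulr_ge0 // (le_trans _ (FB 0%N _)).
  have B0 : 0 <= B by apply: le_trans (FB k kn).
  apply: (@le_trans _ _ (\sum_(i < k.+1) B)).
    by apply: ler_sum => i _; apply: FB; apply: leq_trans kn.
  by rewrite sumr_const card_ord -[B *+ _]mulr_natl ler_wpM2r // ler_nat.
rewrite exprS; apply: (bnd (tri_sum R u)) => // k kn.
rewrite expr2; apply: (bnd (diag_sum R u)) (ltnW kn) => m mn.
rewrite diag_sumP -[leRHS]mulr1.
apply: (bnd (fun i => wal R (unzip1 u) i * wal R (unzip2 u) (m - i))) mn => i _.
by rewrite normrM mulr_ile1 ?normr_wal.
Qed.

Lemma fejer_ker_tail A M n w : size w = M -> (2 ^ A < n <= 2 ^ M)%N ->
  take A w != nseq A (false, false) ->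
  n%:R^-1 * `|fejer_ker R w n| <= tail_bound R A M w.
Proof.
move=> szw /andP[An nM] wA.
have n1 : (1 < n)%N by apply: leq_trans An; rewrite ltnS expn_gt0.
have := up_log_bounds (isT : (1 < 2)%N) n1.
have : (0 < up_log 2 n)%N by rewrite up_log_gt0 n1.
(* [N] is the block with 2^N < n <= 2^(N+1); its summand alone dominates, the others in [tail_bound]
   being nonnegative. *)
case: (up_log 2 n) => // N _ /= /andP[Nn nN].
have AN : (A <= N)%N by rewrite -ltnS -(ltn_exp2l _ _ (isT : 1 < 2)%N) (leq_trans An).
have NM : (N < M)%N by rewrite -(ltn_exp2l _ _ (isT : 1 < 2)%N) (leq_trans Nn).
have term k : 0 <= (2 ^+ k)^-1 * fejer_bound R A (take k.+1 w).
  by rewrite mulr_ge0 ?invr_ge0 ?exprn_ge0 ?fejer_bound_ge0.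
rewrite /tail_bound (bigD1_seq N) ?mem_index_iota ?iota_uniq ?AN //=.
apply: ler_wpDr; first by apply: sumr_ge0.
apply: ler_pM; rewrite ?invr_ge0 ?ler0n //.
  rewrite lef_pV2 ?posrE ?ltr0n ?exprn_gt0 ?(ltn_trans _ n1) //.
  by rewrite -natrX ler_nat ltnW.
rewrite -(fejer_ker_take w nN); apply: fejer_ker_le.
  by rewrite size_take szw; case: ifP => _; lia.
by rewrite take_takel // leqW.
Qed.

(** With 2^A < n <= 2^(A+1), the cell of level [A] at 0 contributes at most 4 by the cubic bound,
    and its complement at most [C] by [tail_bound]. *)
Lemma fejer_ker_norm1 : exists2 K : R, 0 <= K & forall M n, (0 < n <= 2 ^ M)%N ->
  \sum_(w : cell M) n%:R^-1 * `|fejer_ker R w n| <= K * 4 ^+ M.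
Proof.
have [C C0 tailC] := sum_tail_bound R.
exists (C + 4) => [|M n /andP[n0 nM]]; first by rewrite addr_ge0.
have [n1|n1] := leqP n 1%N.
  (* The numerator for n = 1 vanishes, because S_0 = 0. *)
  have -> : n = 1%N by lia.
  rewrite big1 => [|w _]; first by rewrite mulr_ge0 ?addr_ge0 ?exprn_ge0.
  by rewrite fejer_kerS fejer_ker0 tri_sum0 addr0 normr0 mulr0.
have := up_log_bounds (isT : (1 < 2)%N) n1.
have : (0 < up_log 2 n)%N by rewrite up_log_gt0 n1.
case: (up_log 2 n) => // A _ /= /andP[An nA].
have AM : (A < M)%N by rewrite -(ltn_exp2l _ _ (isT : 1 < 2)%N) (leq_trans An).
have nn : 0 < n%:R :> R by rewrite ltr0n.
have zA : size (nseq M (false, false)) == M by rewrite size_nseq.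
have card0 := @card_prefix R A M (Tuple zA) (ltnW AM).
apply: (@le_trans _ _ (\sum_(w : cell M) (tail_bound R A M w +
   (if take A w == take A (nseq M (false, false)) then 4 * 4 ^+ A else 0)))).
  apply: ler_sum => w _; rewrite take_nseq ?(ltnW AM) //.
  case: ifPn => [_|wA]; last by rewrite addr0 (@fejer_ker_tail A M) ?size_tuple ?An.
  apply: ler_wpDl; first exact: tail_bound_ge0.
  rewrite ler_pdivrMl //; apply: le_trans (fejer_ker_le_cube _ _) _.
  rewrite exprS ler_wpM2l ?ler0n // -exprS (_ : (4 : R) = 2 ^+ 2) ?natrX //; last by ring.
  rewrite -exprM mulnC exprM ler_pXn2r ?nnegrE ?ler0n ?exprn_ge0 //.
  by rewrite -natrX ler_nat.
rewrite big_split /= -big_mkcond /=.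
have -> : \sum_(w : cell M | take A w == take A (nseq M (false, false))) (4 * 4 ^+ A : R)
    = 4 * 4 ^+ M.
  rewrite (eq_bigr (fun=> (4 * 4 ^+ A) * 1)) => [|w _]; last by rewrite mulr1.
  by rewrite -mulr_sumr card0 -mulrA -exprD subnKC // ltnW.
have := tailC A M (ltnW AM); lra.
Qed.

Lemma wal_xor M (u v : cell M) i :
  (wal R (unzip1 (xor_cell u v)) i = wal R (unzip1 u) i * wal R (unzip1 v) i) /\
  (wal R (unzip2 (xor_cell u v)) i = wal R (unzip2 u) i * wal R (unzip2 v) i).
Proof.
rewrite /=; have : size v = size u by rewrite !size_tuple.
elim: (tval u) (tval v) i => [|[b c] u' IH] [|[b' c'] v'] //= i sz.
  by rewrite !wal_nil; case: (i == 0%N); rewrite ?mulr1 ?mulr0.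
have [E1 E2] := IH v' i./2 (succn_inj sz).
by rewrite !wal_cons E1 E2; case: (odd i) b b' c c' => [] [] [] [] [] /=; split; ring.
Qed.

End Kernel.

Lemma xor_cellC M (u v : M.-tuple (bool * bool)) : xor_cell u v = xor_cell v u.
Proof.
apply: val_inj => /=; elim: (tval u) (tval v) => [|[b c] u' IH] [|[b' c'] v'] //=.
by rewrite IH /xor_digit /= addbC (addbC c).
Qed.

Lemma xor_cellK M (u : M.-tuple (bool * bool)) : involutive (xor_cell u).
Proof.
move=> v; apply: val_inj => /=; have : size v = size u by rewrite !size_tuple.
elim: (tval u) (tval v) => [|[b c] u' IH] [|[b' c'] v'] //= sz.
by rewrite IH ?(succn_inj sz) // /xor_digit /= !addKb.
Qed.

Lemma take_xor_cell M A (u v : M.-tuple (bool * bool)) :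
  take A (xor_cell u v) = map xor_digit (zip (take A u) (take A v)).
Proof.
rewrite /= -map_take; congr map; have : size v = size u by rewrite !size_tuple.
by elim: A (tval u) (tval v) => [|A IH] [|d u'] [|d' v'] //= sz; rewrite IH // (succn_inj sz).
Qed.

Lemma take_xor_cell_eq0 M A (u v : M.-tuple (bool * bool)) : (A <= M)%N ->
  (take A (xor_cell u v) == nseq A (false, false)) = (take A u == take A v).
Proof.
move=> AM; rewrite take_xor_cell.
have szu : size (take A u) = A by rewrite size_takel ?size_tuple.
have szv : size (take A v) = A by rewrite size_takel ?size_tuple.
elim: A (take A u) (take A v) szu szv {AM} => [|A IH] [|[b c] u'] [|[b' c'] v'] //= [?] [?].
by rewrite !eqseq_cons IH //; case: b b' c c' => [] [] [] [].
Qed.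

(** * The weak type inequality on finite digit sequences *)

Section Averages.
Variables (R : realFieldType) (M : nat).
Local Notation cell := (M.-tuple (bool * bool)).
Implicit Types (F H : cell -> R) (u v w : cell).

(** The conditional expectation on the dyadic cells of level [A], each of which has 4^(M-A)
    points. *)
Definition level_avg A F v : R :=
  (4 ^+ (M - A))^-1 * \sum_(w : cell | take A w == take A v) F w.

Lemma avg_const A F v w : take A v = take A w -> level_avg A F v = level_avg A F w.
Proof. by rewrite /level_avg => ->. Qed.

(** Averaging is self-adjoint and fixes functions that are constant on the cells of level [A]. This
    yields the cancellation in [conv_bad0]. *)
Lemma sum_avg_mul A F H : (A <= M)%N ->
  (forall u v, take A u = take A v -> H u = H v) ->
  \sum_u level_avg A F u * H u = \sum_u F u * H u.
Proof.
move=> AM HA.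
transitivity (\sum_(u : cell) \sum_(w : cell | take A w == take A u)
    (4 ^+ (M - A))^-1 * (F w * H w)).
  apply: eq_bigr => u _; rewrite /level_avg -mulrA mulr_suml mulr_sumr.
  by apply: eq_bigr => w /eqP/HA ->.
rewrite (exchange_big_dep xpredT) //=; apply: eq_bigr => w _.
rewrite (eq_bigr (fun=> (4 ^+ (M - A))^-1 * (F w * H w) * 1)) => [|u _]; last first.
  by rewrite mulr1.
rewrite -mulr_sumr; under eq_bigl do rewrite eq_sym.
by rewrite card_prefix // mulrC mulrA mulfV ?mul1r // expf_neq0 // pnatr_eq0.
Qed.

Lemma avg_top F v : level_avg M F v = F v.
Proof.
rewrite /level_avg subnn expr0 invr1 mul1r (big_pred1 v) // => w.
by rewrite !take_oversize ?size_tuple.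
Qed.

Lemma normr_avg A F v : `|level_avg A F v| <= level_avg A (fun w => `|F w|) v.
Proof.
rewrite /level_avg normrM ger0_norm ?invr_ge0 ?exprn_ge0 //.
by rewrite ler_wpM2l ?invr_ge0 ?exprn_ge0 // ler_norm_sum.
Qed.

(** A cell makes up a quarter of its parent. *)
Lemma avgS A F v : (A < M)%N -> (forall w, 0 <= F w) ->
  level_avg A.+1 F v <= 4 * level_avg A F v.
Proof.
move=> AM F0; rewrite /level_avg -(subnSK AM) exprS invfM.
rewrite [leRHS]mulrA (mulrA 4) divff ?pnatr_eq0 // mul1r.
rewrite ler_wpM2l ?invr_ge0 ?exprn_ge0 //.
rewrite [leRHS](bigID (fun w : cell => take A.+1 w == take A.+1 v)) /=.
apply: ler_wpDr; first exact: sumr_ge0.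
rewrite le_eqVlt; apply/orP; left; apply/eqP; apply: eq_bigl => w.
case: (take A.+1 w =P take A.+1 v) => [E|_]; last by rewrite andbF.
by rewrite andbT -(take_takel w (leqnSn A)) E take_takel // eqxx.
Qed.

End Averages.

Section WeakType.
Variables (R : realFieldType) (M : nat).
Local Notation cell := (M.-tuple (bool * bool)).
Variables K C : R.
Hypothesis C0 : 0 <= C.
Hypothesis normK : forall n, (0 < n <= 2 ^ M)%N ->
  \sum_(w : cell) n%:R^-1 * `|fejer_ker R w n| <= K * 4 ^+ M.
Hypothesis tailC : forall A, (A <= M)%N ->
  \sum_(w : cell) tail_bound R A M w <= C * 4 ^+ M.
Implicit Types (F H c : cell -> R) (u v w : cell).

(** Convolution for the normalized counting measure on [M] digit pairs; on cell averages it gives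
    the Fejer means with n <= 2^M, see [triang_fejerE]. *)
Definition fejer_conv n F v : R :=
  (4 ^+ M)^-1 * \sum_u F u * (n%:R^-1 * fejer_ker R (xor_cell u v) n).

Lemma convD n F H v : fejer_conv n (fun u => F u + H u) v = fejer_conv n F v + fejer_conv n H v.
Proof.
rewrite /fejer_conv -mulrDr -big_split /=; congr (_ * _); apply: eq_bigr => u _.
by rewrite mulrDl.
Qed.

Lemma conv_sum n (I : finType) (F : I -> cell -> R) v :
  fejer_conv n (fun u => \sum_i F i u) v = \sum_i fejer_conv n (F i) v.
Proof.
rewrite /fejer_conv -mulr_sumr; congr (_ * _); rewrite exchange_big /=.
by apply: eq_bigr => u _; rewrite mulr_suml.
Qed.

Lemma sum_xor (phi : cell -> R) v : \sum_u phi (xor_cell v u) = \sum_u phi u.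
Proof. by rewrite [RHS](reindex_inj (inv_inj (xor_cellK v))). Qed.

Lemma conv_le_sup n F v B : (0 < n <= 2 ^ M)%N -> (forall u, `|F u| <= B) ->
  `|fejer_conv n F v| <= K * B.
Proof.
move=> nM FB; rewrite /fejer_conv normrM ger0_norm ?invr_ge0 ?exprn_ge0 //.
rewrite ler_pdivrMl ?exprn_gt0 //; apply: le_trans (ler_norm_sum _ _ _) _.
have B0 : 0 <= B := le_trans (normr_ge0 _) (FB v).
apply: (@le_trans _ _ (\sum_u B * (n%:R^-1 * `|fejer_ker R (xor_cell v u) n|))).
  apply: ler_sum => u _; rewrite !normrM xor_cellC (@ger0_norm _ n%:R^-1) ?invr_ge0 ?ler0n //.
  by rewrite ler_wpM2r // mulr_ge0 ?invr_ge0 ?ler0n.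
rewrite -mulr_sumr (sum_xor (fun w => n%:R^-1 * `|fejer_ker R w n|)).
rewrite (_ : 4 ^+ M * (K * B) = B * (K * 4 ^+ M)); last by ring.
by rewrite ler_wpM2l // normK.
Qed.

(** * Calderon-Zygmund decomposition at height [lam] *)

Section Decomposition.
Variables (c : cell -> R) (lam : R).
Hypothesis lam_gt0 : 0 < lam.
Let absc u := `|c u|.

(* Level A is the first one on which the average of |c| around v exceeds lam. *)
Definition stopping A v := (lam < level_avg A absc v) && [forall B : 'I_A, level_avg B absc v <= lam].

(** All bad pieces of level [A] together. The mean over each cell of that level is zero, because
    [stopping A] depends on the first [A] digits only. *)
Definition bad_part A v := if stopping A v then c v - level_avg A c v else 0.

Definition good_part v := c v - \sum_(A < M.+1) bad_part A v.

Lemma stopping_uniq A B v : stopping A v -> stopping B v -> A = B.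
Proof.
move=> /andP[lA /forallP sA] /andP[lB /forallP sB].
case: (ltngtP A B) => // AB.
  by have := sB (Ordinal AB); rewrite leNgt lA.
by have := sA (Ordinal AB); rewrite leNgt lB.
Qed.

Lemma stopping_const A u v : take A u = take A v -> stopping A u = stopping A v.
Proof.
move=> E; rewrite /stopping (avg_const _ E); congr (_ && _).
apply: eq_forallb => B; congr (_ <= _); apply: avg_const.
by rewrite -(take_takel u (ltnW (ltn_ord B))) E take_takel // ltnW.
Qed.

(** On a stopping cell the good part is the average of [c], controlled by four times the parent's
    average of |c|, which is at most [lam]; the hypothesis covers level 0. Elsewhere it is [c]
    itself, and |c| <= [lam] there because cells of level [M] are points. *)
Lemma normr_good v : (forall u, level_avg 0 absc u <= lam) -> `|good_part v| <= 4 * lam.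
Proof.
move=> lam0; case: (pickP (fun A : 'I_M.+1 => stopping A v)) => [A sA|none]; last first.
  rewrite /good_part big1 ?subr0 => [|A _]; last by rewrite /bad_part none.
  suff : `|c v| <= lam by move: lam_gt0; lra.
  rewrite leNgt; apply/negP => lv.
  have ex : exists A, (A <= M)%N && (lam < level_avg A absc v).
    by exists M; rewrite leqnn avg_top.
  case: (ex_minnP ex) => A /andP[AM lA] Amin.
  have := none (Ordinal (AM : A < M.+1)%N); rewrite /stopping /= lA /= => /negP; apply.
  apply/forallP => B; rewrite leNgt; apply/negP => lB.
  have := Amin B; rewrite lB (leq_trans (ltnW (ltn_ord B)) AM) => /(_ isT).
  by rewrite leqNgt ltn_ord.
have -> : good_part v = level_avg A c v.
  rewrite /good_part (bigD1 A) //= big1 => [|B BA].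
    by rewrite /bad_part sA addr0 opprB addrC subrK.
  by rewrite /bad_part; case: ifP => // sB; rewrite -val_eqE /= (stopping_uniq sB sA) eqxx in BA.
apply: le_trans (normr_avg _ _ _) _.
have AM : (A <= M)%N by rewrite -ltnS ltn_ord.
case: A sA AM => [[|A] Al] /= sA AM; first by apply: (le_trans (lam0 v)); move: lam_gt0; lra.
apply: le_trans (avgS _ AM _) _ => [w|]; first by [].
rewrite ler_wpM2l //.
by move: sA => /andP[_ /forallP/(_ (Ordinal (ltnSn A)))].
Qed.

(** For n <= 2^A the kernel is constant on the cells of level [A], on which the bad part has mean
    zero. *)
Lemma conv_bad0 A n v : (A <= M)%N -> (n <= 2 ^ A)%N -> fejer_conv n (bad_part A) v = 0.
Proof.
move=> AM nA; rewrite /fejer_conv.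
pose H u : R := (stopping A u)%:R * (n%:R^-1 * fejer_ker R (xor_cell u v) n).
have HA u w : take A u = take A w -> H u = H w.
  move=> E; rewrite /H (stopping_const E) -(fejer_ker_take _ (xor_cell u v) nA)
    -(fejer_ker_take _ (xor_cell w v) nA).
  by rewrite !take_xor_cell E.
rewrite (eq_bigr (fun u => c u * H u - level_avg A c u * H u)) => [|u _].
  by rewrite sumrB sum_avg_mul // subrr mulr0.
by rewrite /bad_part /H; case: (stopping A u) => /=; ring.
Qed.

(** If v is in no stopping cell of level [A], each u that contributes lies in another cell of that
    level, so the dyadic sum of u and v is off the cell at 0 and [tail_bound] applies. The right
    side is free of n. *)
Lemma conv_bad_le A n v : (A <= M)%N -> (0 < n <= 2 ^ M)%N -> ~~ stopping A v ->
  `|fejer_conv n (bad_part A) v| <=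
  (4 ^+ M)^-1 * \sum_u `|bad_part A u| * tail_bound R A M (xor_cell u v).
Proof.
move=> AM /andP[n0 nM] sv; have [nA|nA] := leqP n (2 ^ A)%N.
  rewrite conv_bad0 // normr0 mulr_ge0 ?invr_ge0 ?exprn_ge0 //.
  by apply: sumr_ge0 => u _; rewrite mulr_ge0 ?tail_bound_ge0.
rewrite /fejer_conv normrM ger0_norm ?invr_ge0 ?exprn_ge0 // ler_wpM2l ?invr_ge0 ?exprn_ge0 //.
apply: le_trans (ler_norm_sum _ _ _) _; apply: ler_sum => u _.
rewrite normrM; have [E|uv] := eqVneq (take A u) (take A v).
  by rewrite /bad_part (stopping_const E) (negbTE sv) normr0 !mul0r.
rewrite ler_wpM2l // normrM ger0_norm ?invr_ge0 ?ler0n //.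
by rewrite fejer_ker_tail ?size_tuple ?nA // take_xor_cell_eq0.
Qed.

Lemma sum_bad A : (A <= M)%N ->
  \sum_u `|bad_part A u| <= 2 * \sum_(u | stopping A u) `|c u|.
Proof.
move=> AM.
apply: (@le_trans _ _ (\sum_u (absc u + level_avg A absc u) * (stopping A u)%:R)).
  apply: ler_sum => u _; rewrite /bad_part; case: (stopping A u); last by rewrite normr0 mulr0.
  by rewrite mulr1 (le_trans (ler_normB _ _)) // lerD2l normr_avg.
under eq_bigr do rewrite mulrDl.
rewrite big_split /= sum_avg_mul // => [|u v /stopping_const -> //].
rewrite [in leRHS]big_mkcond /= le_eqVlt; apply/orP; left; apply/eqP.
rewrite -mulr2n mulr_natl; congr (_ *+ _); apply: eq_bigr => u _.
by case: (stopping A u); rewrite ?mulr1 ?mulr0.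
Qed.

Lemma sum_stop : \sum_(A < M.+1) \sum_(u | stopping A u) `|c u| <= \sum_u `|c u|.
Proof.
under eq_bigr do rewrite big_mkcond.
rewrite exchange_big /=; apply: ler_sum => u _; rewrite -big_mkcond /=.
case: (pickP (fun A : 'I_M.+1 => stopping A u)) => [A sA|none]; last by rewrite big_pred0.
rewrite (big_pred1 A) // => B; apply/idP/eqP => [sB|-> //].
by apply: val_inj; apply: stopping_uniq sB sA.
Qed.

Lemma card_stop A : (A <= M)%N -> lam * \sum_(u | stopping A u) 1 <= \sum_(u | stopping A u) `|c u|.
Proof.
move=> AM.
have -> : \sum_(u | stopping A u) `|c u| = \sum_u absc u * (stopping A u)%:R.
  rewrite big_mkcond /=; apply: eq_bigr => u _.
  by case: (stopping A u); rewrite ?mulr1 ?mulr0.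
rewrite -(@sum_avg_mul _ _ A) // => [|u v /stopping_const -> //].
rewrite mulr_sumr big_mkcond /=; apply: ler_sum => u _.
by case: ifPn; rewrite ?mulr0 ?mulr1 // => /andP[/ltW].
Qed.

(** The threshold splits into 4 K [lam] for the good part and [lam] for the bad parts. In the
    constant, 1 accounts for the stopping cells and 2 C for the bad parts off them. *)
Lemma weak_type_aux :
  lam * \sum_(v | [exists n : 'I_(2 ^ M).+1, (0 < n)%N && ((4 * K + 1) * lam < `|fejer_conv n c v|)]) 1
  <= (1 + 2 * C) * \sum_u `|c u|.
Proof.
have sumc0 : 0 <= \sum_u `|c u| by apply: sumr_ge0.
have sumC0 : 0 <= C * \sum_u `|c u| by rewrite mulr_ge0.
(* If the mean of |c| over the whole space exceeds [lam], the right side already bounds [lam] times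
   the number of all points. *)
have [/existsP[v0 big]|] := boolP [exists u, lam < level_avg 0 absc u].
  apply: (@le_trans _ _ (lam * \sum_(v : cell) 1)).
    apply: ler_wpM2l; first exact: ltW.
    rewrite [leRHS](bigID (fun v => [exists n : 'I_(2 ^ M).+1,
      (0 < n)%N && ((4 * K + 1) * lam < `|fejer_conv n c v|)])) /=.
    by apply: ler_wpDr => //; apply: sumr_ge0.
  have := @card_prefix R 0 M v0 (leq0n _).
  under eq_bigl do rewrite !take0 eqxx; move=> ->.
  move: big; rewrite /level_avg; under eq_bigl do rewrite !take0 eqxx.
  by rewrite subn0 ltr_pdivlMl ?exprn_gt0 // /absc; lra.
rewrite negb_exists => /forallP small.
have {}small u : level_avg 0 absc u <= lam by rewrite leNgt small.
(* A majorant of the bad parts off the stopping cells, uniform in n, so that Chebyshev's inequality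
   handles the supremum. *)
pose B v := \sum_(A < M.+1) (4 ^+ M)^-1 *
  \sum_u `|bad_part A u| * tail_bound R A M (xor_cell u v).
have B0 v : 0 <= B v.
  apply: sumr_ge0 => A _; rewrite mulr_ge0 ?invr_ge0 ?exprn_ge0 //.
  by apply: sumr_ge0 => u _; rewrite mulr_ge0 ?tail_bound_ge0.
apply: (@le_trans _ _ (\sum_v (lam * (\sum_(A < M.+1 | stopping A v) 1) + B v))).
  rewrite mulr_sumr big_mkcond /=; apply: ler_sum => v _; rewrite mulr1.
  have S0 : 0 <= \sum_(A < M.+1 | stopping A v) (1 : R) by apply: sumr_ge0.
  case: ifPn => [/existsP[n /andP[n0 big]]|_]; last first.
    by rewrite addr_ge0 // mulr_ge0 // ltW.
  have [/existsP[A sA]|] := boolP [exists A : 'I_M.+1, stopping A v].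
    rewrite (bigD1 A) //= mulrDr mulr1 -addrA lerDl addr_ge0 // mulr_ge0 ?(ltW lam_gt0) //.
    by apply: sumr_ge0.
  rewrite negb_exists => /forallP nos; apply: ler_wpDl.
    by rewrite mulr_ge0 // ltW.
  have nM : (0 < n <= 2 ^ M)%N by rewrite n0 -ltnS ltn_ord.
  have goodv := conv_le_sup v nM (fun u => normr_good u small).
  have badv : `|\sum_(A < M.+1) fejer_conv n (bad_part A) v| <= B v.
    apply: le_trans (ler_norm_sum _ _ _) _; apply: ler_sum => A _.
    by apply: conv_bad_le; rewrite // -ltnS ltn_ord.
  have cE : fejer_conv n c v = fejer_conv n good_part v + \sum_(A < M.+1) fejer_conv n (bad_part A) v.
    rewrite -conv_sum -convD /fejer_conv; congr (_ * _); apply: eq_bigr => u _.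
    by rewrite /good_part subrK.
  have := ler_normD (fejer_conv n good_part v) (\sum_(A < M.+1) fejer_conv n (bad_part A) v).
  rewrite -cE; lra.
rewrite big_split /= -mulr_sumr (exchange_big_dep xpredT) //=.
have stops : lam * \sum_(A < M.+1) \sum_(v | stopping A v) 1 <= \sum_u `|c u|.
  apply: le_trans sum_stop; rewrite mulr_sumr; apply: ler_sum => A _.
  by apply: card_stop; rewrite -ltnS ltn_ord.
suff bads : \sum_v B v <= 2 * C * \sum_u `|c u| by move: stops bads; lra.
rewrite /B exchange_big /=.
apply: (@le_trans _ _ (\sum_(A < M.+1) 2 * C * \sum_(u | stopping A u) `|c u|)); last first.
  by rewrite -mulr_sumr; apply: ler_wpM2l; [rewrite mulr_ge0|exact: sum_stop].
apply: ler_sum => A _; have AM : (A <= M)%N by rewrite -ltnS ltn_ord.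
rewrite -mulr_sumr exchange_big /= ler_pdivrMl ?exprn_gt0 //.
under eq_bigr do rewrite -mulr_sumr (sum_xor (fun w => tail_bound R A M w)).
rewrite -mulr_suml.
apply: (@le_trans _ _ ((2 * \sum_(u | stopping A u) `|c u|) * (C * 4 ^+ M))).
  apply: ler_pM; rewrite ?sum_bad ?tailC //.
    by apply: sumr_ge0.
  by apply: sumr_ge0 => w _; apply: tail_bound_ge0.
by rewrite le_eqVlt; apply/orP; left; apply/eqP; ring.
Qed.

End Decomposition.

End WeakType.

Lemma weak_type (R : realFieldType) : exists2 C : R, 0 <= C &
  forall M (c : M.-tuple (bool * bool) -> R) (lam : R), 0 < lam ->
  lam * #|[pred v | [exists n : 'I_(2 ^ M).+1, (0 < n)%N && (lam < `|fejer_conv n c v|)]]|%:R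
  <= C * \sum_u `|c u|.
Proof.
have [K K0 normK] := fejer_ker_norm1 R; have [C C0 tailC] := sum_tail_bound R.
have K1 : 0 < 4 * K + 1 by lra.
exists ((4 * K + 1) * (1 + 2 * C)) => [|M c lam lam0]; first by apply: mulr_ge0; lra.
have lam' : 0 < lam / (4 * K + 1) by rewrite divr_gt0.
have := weak_type_aux C0 (@normK M) (fun A => @tailC A M) c lam'.
rewrite (mulrC (4 * K + 1)) divfK ?gt_eqF // sumr_const => H.
by rewrite -mulrA -ler_pdivrMl // mulrA (mulrC _^-1).
Qed.

(** * Step functions on finite digit sequences *)

Section StepFunctions.
Variable R : realFieldType.
Implicit Types (u v w : seq (bool * bool)).
Local Notation cell M := (M.-tuple (bool * bool)).

(** The factors of the four possible first pairs add up to (1 + z)^2 + (1 - z)^2 + 2 (1 - z^2) = 4,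
    so only the constant coefficient keeps a nonzero mean. *)
Lemma sum_diag_sum M m :
  \sum_(w : cell M) diag_sum R w m = 4 ^+ M * (m == 0%N)%:R.
Proof.
elim: M m => [|M IH] m.
  by rewrite (sum_tuple0 (fun w => diag_sum R w m)) diag_sum_nil mul1r.
rewrite sum_tupleS /= sum_digits /=.
under eq_bigr do rewrite diag_sum_cons.
under [X in _ + X + _ + _]eq_bigr do rewrite diag_sum_cons.
under [X in _ + X + _]eq_bigr do rewrite diag_sum_cons.
under [X in _ + X]eq_bigr do rewrite diag_sum_cons.
rewrite -!big_split /= /digit_sign /=.
case om: (odd m).
  rewrite big1 => [|w _]; last by ring.
  by case: m om => //= m _; rewrite mulr0.
rewrite (eq_bigr (fun w : cell M => 4 * diag_sum R w m./2)) => [|w _]; last by ring.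
rewrite -mulr_sumr IH mulrA -exprS.
by case: m om => [|[|m]].
Qed.

(** Digits beyond [A] average out: against a function of the first [A] digits the kernel acts like
    its truncation, which keeps only the w_i with i < 2^A. *)
Lemma sum_take_diag_sum (A M : nat) (H : seq (bool * bool) -> R) m : (A <= M)%N ->
  \sum_(w : cell M) H (take A w) * diag_sum R w m =
  4 ^+ (M - A) * \sum_(p : cell A) H p * diag_sum R p m.
Proof.
elim: A M H m => [|A IH] M H m AM.
  under eq_bigr do rewrite take0.
  rewrite (sum_tuple0 (fun p => H p * diag_sum R p m)) -mulr_sumr sum_diag_sum.
  by rewrite subn0 diag_sum_nil; ring.
case: M AM => // M AM; rewrite !sum_tupleS mulr_sumr; apply: eq_bigr => -[b c] _ /=.
rewrite subSS.
have /= {}IH k := IH M (fun u => H ((b, c) :: u)) k AM.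
under eq_bigr do rewrite diag_sum_cons.
under [in RHS]eq_bigr do rewrite diag_sum_cons.
case: (odd m).
  transitivity (\sum_(w : cell M) (digit_sign R b + digit_sign R c) *
      (H ((b, c) :: take A w) * diag_sum R w m./2)).
    by apply: eq_bigr => w _ /=; ring.
  rewrite -mulr_sumr IH mulrCA; congr (_ * _); rewrite mulr_sumr.
  by apply: eq_bigr => p _; ring.
transitivity (\sum_(w : cell M) (H ((b, c) :: take A w) * diag_sum R w m./2) +
   digit_sign R b * digit_sign R c * \sum_(w : cell M) (H ((b, c) :: take A w) *
   (if m is 0 then 0 else diag_sum R w m./2.-1))).
  by rewrite mulr_sumr -big_split /=; apply: eq_bigr => w _ /=; ring.
have IH2 : \sum_(w : cell M) (H ((b, c) :: take A w) *
   (if m is 0 then 0 else diag_sum R w m./2.-1)) =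
   4 ^+ (M - A) * \sum_(p : cell A) (H ((b, c) :: p) *
   (if m is 0 then 0 else diag_sum R p m./2.-1)).
  by case: m => [|m]; [rewrite !big1 ?mulr0 // => *; rewrite mulr0|exact: IH].
rewrite IH2 IH mulrCA -mulrDr; congr (_ * _); rewrite mulr_sumr -big_split /=.
by apply: eq_bigr => p _; ring.
Qed.

Lemma sum_take_fejer_ker (A M : nat) (H : seq (bool * bool) -> R) n : (A <= M)%N ->
  \sum_(w : cell M) H (take A w) * fejer_ker R w n =
  4 ^+ (M - A) * \sum_(p : cell A) H p * fejer_ker R p n.
Proof.
move=> AM; rewrite /fejer_ker /tri_sum.
under eq_bigr do rewrite mulr_sumr.
under eq_bigr do under eq_bigr do rewrite mulr_sumr.
rewrite exchange_big /=; under eq_bigr do rewrite exchange_big /=.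
under eq_bigr do under eq_bigr do rewrite sum_take_diag_sum //.
under eq_bigr do rewrite -mulr_sumr.
rewrite -mulr_sumr; congr (_ * _); symmetry.
under eq_bigr do rewrite mulr_sumr.
under eq_bigr do under eq_bigr do rewrite mulr_sumr.
by rewrite exchange_big /=; under eq_bigr do rewrite exchange_big /=.
Qed.

(** The sum on the right has a fixed number of terms and n enters it through the kernel only,
    whatever [M] is. Convergence for step functions thus becomes convergence of truncated kernels at
    finitely many points. *)
Lemma conv_step (A M : nat) (h : seq (bool * bool) -> R) n (v : cell M) : (A <= M)%N ->
  fejer_conv n (fun u : cell M => h (take A u)) v =
  (4 ^+ A)^-1 * \sum_(p : cell A)
    h (map xor_digit (zip (take A v) p)) * (n%:R^-1 * fejer_ker R p n).
Proof.
move=> AM; rewrite /fejer_conv -(sum_xor _ v).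
pose H p := h (map xor_digit (zip (take A v) p)).
rewrite (eq_bigr (fun w : cell M => n%:R^-1 * (H (take A w) * fejer_ker R w n))); last first.
  by move=> w _; rewrite take_xor_cell (xor_cellC (xor_cell v w)) xor_cellK mulrCA.
rewrite -mulr_sumr (sum_take_fejer_ker H) //.
have -> : (4 : R) ^+ M = 4 ^+ (M - A) * 4 ^+ A by rewrite -exprD subnK.
have n4 k : (4 : R) ^+ k != 0 by rewrite expf_neq0 // pnatr_eq0.
rewrite invfM (mulrCA n%:R^-1) [X in X * _ = _]mulrC -mulrA mulKf //.
congr (_ * _); rewrite mulr_sumr /H.
by apply: eq_bigr => p _; ring.
Qed.

Lemma wpoly1 s : (wpoly R s).[1] = if s == nseq (size s) false then 2 ^+ size s else 0.
Proof.
elim: s => [|b s IH]; first by rewrite hornerC.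
rewrite /= hornerM horner_comp hornerXn expr1n IH hornerD hornerC hornerZ hornerX mulr1.
rewrite /digit_sign eqseq_cons; case: b => /=; first by rewrite subrr mul0r.
by case: ifP; rewrite ?mulr0 // exprS.
Qed.

(** Once n exceeds the degree, T_n is the sum of all coefficients, i.e. the value at 1, where a
    digit 1 contributes the factor 1 - 1 = 0. *)
Lemma tri_sum_eventually u : exists N, forall n, (N <= n)%N ->
  tri_sum R u n = if u == nseq (size u) (false, false) then 4 ^+ size u else 0.
Proof.
set P := wpoly R (unzip1 u) * wpoly R (unzip2 u).
exists (size P) => n Pn; rewrite /tri_sum /diag_sum -/P.
transitivity (P.[1]).
  rewrite (@horner_coef_wide _ n) //; apply: eq_bigr => i _.
  by rewrite expr1n mulr1.
have -> : (u == nseq (size u) (false, false)) =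
    (unzip1 u == nseq (size u) false) && (unzip2 u == nseq (size u) false).
  elim: u {P Pn} => [|[b c] u IH] //=.
  by rewrite !eqseq_cons IH xpair_eqE -!andbA; congr (_ && _); rewrite !andbA (andbC (c == _)).
rewrite hornerM !wpoly1 !size_map.
case: eqP => _; case: eqP => _; rewrite /= ?mul0r ?mulr0 //.
by rewrite -exprMn; congr (_ ^+ _); ring.
Qed.

End StepFunctions.

Local Open Scope classical_set_scope.

(** * Dyadic cells and Fourier coefficients *)

Lemma nat_digit_small n j : (n < 2 ^ j)%N -> nat_digit n j = false.
Proof. by move=> nj; rewrite /nat_digit divn_small. Qed.

Lemma nat_digitS n j : nat_digit n j.+1 = nat_digit n./2 j.
Proof. by rewrite /nat_digit expnS divnMA divn2. Qed.

Section Digits.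
Variable R : realType.
Implicit Types (x : R) (y : R * R) (s : seq bool).

Definition digits M x : seq bool := mkseq (real_digit x) M.

Lemma sum_nat_digit (d : nat -> bool) n M : (n < 2 ^ M)%N ->
  (\sum_(j < n) nat_digit n j * d j = \sum_(j < M) nat_digit n j * d j)%N.
Proof.
have ext K L : (n < 2 ^ K)%N -> (\sum_(j < K + L) nat_digit n j * d j =
    \sum_(j < K) nat_digit n j * d j)%N.
  move=> nK; rewrite big_split_ord /= [X in (_ + X)%N]big1 ?addn0 // => j _.
  by rewrite nat_digit_small // (leq_trans nK) // leq_exp2l // leq_addr.
move=> nM; rewrite -(ext _ M (ltn_expl n (isT : (1 < 2)%N))) addnC.
exact: ext.
Qed.

Lemma wal_mkseq (d : nat -> bool) M n : (n < 2 ^ M)%N ->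
  wal R (mkseq d M) n = (-1) ^+ (\sum_(j < M) nat_digit n j * d j)%N.
Proof.
elim: M d n => [|M IH] d n nM.
  by move: nM; rewrite expn0 ltnS leqn0 => /eqP ->; rewrite wal_nil big_ord0.
have -> : mkseq d M.+1 = d 0%N :: mkseq (d \o succn) M.
  by rewrite /mkseq /= (iotaDl 1 0) -map_comp.
rewrite wal_cons IH; last by move: nM; rewrite expnS; lia.
rewrite big_ord_recl exprD; congr (_ * _).
  by rewrite /nat_digit expn0 divn1 mulnb.
by under [in RHS]eq_bigr do rewrite nat_digitS.
Qed.

Lemma walsh_digits M n x : (n < 2 ^ M)%N -> walsh n x = wal R (digits M x) n.
Proof. by move=> nM; rewrite wal_mkseq // -sum_nat_digit. Qed.

(** The left end of the dyadic interval with digits [s], the binary fraction 0.s. *)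
Fixpoint lower s : R := if s is b :: s' then (b%:R + lower s') / 2 else 0.

Lemma lower_itv s : 0 <= lower s /\ lower s + (2 ^+ size s)^-1 <= 1.
Proof.
elim: s => [|b s [IH1 IH2]] /=; first by rewrite expr0 invr1; split; lra.
rewrite exprS invfM.
by case: b => /=; split; lra.
Qed.

Lemma real_digit0 x : 0 <= x < 1 -> real_digit x 0 = (1 / 2 <= x).
Proof.
move=> /andP[x0 x1]; rewrite /real_digit expr1.
have [x2|x2] := leP (1 / 2) x.
  by rewrite (@truncn_def _ _ 1) //; apply/andP; split; lra.
by rewrite (@truncn_def _ _ 0) // mulr0n; apply/andP; split; lra.
Qed.

(** The doubling map 2x mod 1 shifts the digits: the integer split off after scaling is a multiple
    of 2^(j+1), hence even, and does not change the parity. *)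
Lemma real_digitS x j : 0 <= x < 1 ->
  real_digit x j.+1 = real_digit (2 * x - (real_digit x 0)%:R) j.
Proof.
move=> x01; set b := real_digit x 0.
have x0 : 0 <= 2 * x - b%:R.
  by rewrite /b real_digit0 //; case: (leP (1 / 2) x) x01 => /= ? /andP[? ?]; lra.
rewrite /real_digit.
have -> : x * 2 ^+ j.+2 = (b * 2 ^ j.+1)%N%:R + (2 * x - b%:R) * 2 ^+ j.+1.
  by rewrite exprS natrM natrX; ring.
rewrite truncnD ?natr_nat //; last by rewrite nnegrE mulr_ge0 ?exprn_ge0.
by rewrite natrK oddD oddM oddX /= andbF.
Qed.

Lemma digitsS M x : 0 <= x < 1 -> digits M.+1 x =
  real_digit x 0 :: digits M (2 * x - (real_digit x 0)%:R).
Proof.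
move=> x01; rewrite /digits /mkseq /= (iotaDl 1 0) -map_comp; congr (_ :: _).
by apply: eq_map => j /=; rewrite real_digitS.
Qed.

Lemma digits_eq M s x : size s = M -> 0 <= x < 1 ->
  (digits M x == s) = (lower s <= x < lower s + (2 ^+ M)^-1).
Proof.
move=> <- {M}; elim: s x => [|b s IH] x x01; first by rewrite /= expr0 invr1 add0r x01.
rewrite /= digitsS // eqseq_cons real_digit0 // IH; last first.
  by case: (leP (1 / 2) x) x01 => /= ? /andP[? ?]; apply/andP; split; lra.
have [? ?] := lower_itv s.
rewrite exprS invfM.
by case: (leP (1 / 2) x) x01 => ? /andP[? ?]; case: b => /=; apply/idP/idP; 
  rewrite ?andbF //; move=> /andP[? ?]; try apply/andP; try split; lra.
Qed.

End Digits.

Section Cells.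
Variable R : realType.
Local Notation mu := (leb2 R).
Implicit Types (y : R * R) (f : R * R -> R).

Definition cell_digits M y : M.-tuple (bool * bool) :=
  [tuple of mkseq (fun j => (real_digit y.1 j, real_digit y.2 j)) M].

Lemma unzip1_dig M y : unzip1 (cell_digits M y) = digits M y.1.
Proof. by rewrite /unzip1 /= -map_comp. Qed.

Lemma unzip2_dig M y : unzip2 (cell_digits M y) = digits M y.2.
Proof. by rewrite /unzip2 /= -map_comp. Qed.

Definition dyadic_cell M (t : M.-tuple (bool * bool)) : set (R * R) :=
  [set y | I2 y /\ cell_digits M y = t].

Lemma dcellE M (t : M.-tuple (bool * bool)) : dyadic_cell t =
  `[lower R (unzip1 t), lower R (unzip1 t) + (2 ^+ M)^-1[ `*`
  `[lower R (unzip2 t), lower R (unzip2 t) + (2 ^+ M)^-1[.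
Proof.
have sz1 : size (unzip1 t) = M by rewrite size_map size_tuple.
have sz2 : size (unzip2 t) = M by rewrite size_map size_tuple.
have [l1 l1'] := lower_itv R (unzip1 t); have [l2 l2'] := lower_itv R (unzip2 t).
rewrite sz1 in l1'; rewrite sz2 in l2'.
apply/seteqP; split => -[a b]; rewrite /dyadic_cell /I2 /= !in_itv /=.
  move=> [[a01 b01] E].
  rewrite -!digits_eq // -E.
  by rewrite (unzip1_dig M (a, b)) (unzip2_dig M (a, b)) !eqxx.
move=> [A B]; have a01 : 0 <= a < 1 by move: A => /andP[? ?]; apply/andP; split; lra.
have b01 : 0 <= b < 1 by move: B => /andP[? ?]; apply/andP; split; lra.
split=> //; rewrite -digits_eq // in A; rewrite -digits_eq // in B.
apply: val_inj; rewrite /= -[RHS]zip_unzip -(eqP A) -(eqP B).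
by rewrite -(unzip1_dig M (a, b)) -(unzip2_dig M (a, b)) zip_unzip.
Qed.

Lemma measurable_dcell M (t : M.-tuple (bool * bool)) : measurable (dyadic_cell t).
Proof. by rewrite dcellE; apply: measurableX; exact: measurable_itv. Qed.

Lemma measure_dcell M (t : M.-tuple (bool * bool)) :
  mu (dyadic_cell t) = ((4 ^+ M)^-1)%:E.
Proof.
rewrite dcellE product_measure1E; [|exact: measurable_itv|exact: measurable_itv].
rewrite /= !lebesgue_measure_itv /= !lte_fin !ltrDl !invr_gt0 !exprn_gt0 //.
rewrite -!EFinD -EFinM; congr EFin; rewrite addrC addKr addrC addKr.
by rewrite -invfM -exprMn; congr (_ ^+ _)^-1; ring.
Qed.

Lemma I2_dcell M : @I2 R = \big[setU/set0]_(t <- index_enum (M.-tuple (bool * bool))) dyadic_cell t.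
Proof.
rewrite -bigcup_seq; apply/seteqP; split => [y yI|y [t _ []] //].
by exists (cell_digits M y) => //=; rewrite mem_index_enum.
Qed.

Lemma trivIset_dcell M D : trivIset D (@dyadic_cell M).
Proof. by move=> s t _ _ [y [[_ <-] [_ <-]]]. Qed.

Lemma measurable_I2 : measurable (@I2 R).
Proof. by apply: measurableX; exact: measurable_itv. Qed.

Lemma measure_I2 : mu (@I2 R) = 1%:E.
Proof.
rewrite /I2 product_measure1E; [|exact: measurable_itv|exact: measurable_itv].
by rewrite /= !lebesgue_measure_itv /= !lte_fin ltr01 oppr0 adde0 mule1.
Qed.

Lemma dcell_sub M (t : M.-tuple (bool * bool)) : dyadic_cell t `<=` @I2 R.
Proof. by move=> y []. Qed.

Lemma integrable_dcell M (t : M.-tuple (bool * bool)) f :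
  mu.-integrable (@I2 R) (EFin \o f) -> mu.-integrable (dyadic_cell t) (EFin \o f).
Proof.
apply: integrableS; [exact: measurable_I2|exact: measurable_dcell|exact: dcell_sub].
Qed.

Lemma Rintegral_I2_dcell M f :
  mu.-integrable (@I2 R) (EFin \o f) ->
  \int[mu]_(x in @I2 R) f x =
  \sum_(t : M.-tuple (bool * bool)) \int[mu]_(x in dyadic_cell t) f x.
Proof.
move=> fi; rewrite /Rintegral [in LHS](I2_dcell M) integral_bigsetU_EFin //.
- rewrite -sum_fine // => t _; apply: integrable_fin_num (integrable_dcell t fi).
  exact: measurable_dcell.
- exact: measurable_dcell.
- exact: index_enum_uniq.
- exact: trivIset_dcell.
- by rewrite -I2_dcell; exact: measurable_int fi.
Qed.

Lemma cellwiseE M (P : pred (M.-tuple (bool * bool))) :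
  [set y | I2 y /\ P (cell_digits M y)] = \big[setU/set0]_(t <- enum P) dyadic_cell t.
Proof.
rewrite -bigcup_seq; apply/seteqP; split => [y [yI Py]|y [t] /=].
  by exists (cell_digits M y) => //=; rewrite mem_enum.
by rewrite mem_enum => Pt [yI yt]; split => //; rewrite yt.
Qed.

Lemma measurable_cellwise M (P : pred (M.-tuple (bool * bool))) :
  measurable [set y | I2 y /\ P (cell_digits M y)].
Proof. by rewrite cellwiseE; apply: bigsetU_measurable => t _; exact: measurable_dcell. Qed.

Lemma measure_cellwise M (P : pred (M.-tuple (bool * bool))) :
  mu [set y | I2 y /\ P (cell_digits M y)] = (#|P|%:R / 4 ^+ M)%:E.
Proof.
rewrite -[LHS]mul1e -integral_cst; last exact: measurable_cellwise.
rewrite cellwiseE ge0_integral_bigsetU.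
- rewrite (eq_bigr (fun=> ((4 ^+ M)^-1)%:E)) => [|t _].
    by rewrite sumEFin big_const_seq count_predT -cardE iter_addr addr0 mulr_natl.
  by rewrite integral_cst; [rewrite mul1e; exact: measure_dcell|exact: measurable_dcell].
- exact: measurable_dcell.
- exact: enum_uniq.
- exact: trivIset_dcell.
- exact: measurable_cst.
- by move=> *; rewrite lee_fin.
Qed.

Lemma measurable_step M (h : M.-tuple (bool * bool) -> R) :
  measurable_fun (@I2 R) (h \o cell_digits M).
Proof.
move=> _ Y mY.
rewrite (_ : _ `&` _ = [set y | I2 y /\ `[< Y (h (cell_digits M y)) >]]).
  exact: (measurable_cellwise (fun t => `[< Y (h t) >])).
by apply/seteqP; split => y /= [yI /asboolP].
Qed.

Lemma integrable_step M f (h : M.-tuple (bool * bool) -> R) :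
  mu.-integrable (@I2 R) (EFin \o f) ->
  mu.-integrable (@I2 R) (EFin \o (fun x => f x * h (cell_digits M x))).
Proof.
move=> fi; apply: (@integrableMl _ _ _ mu _ measurable_I2 _ (h \o cell_digits M) fi).
  exact: measurable_step.
exists (\sum_t `|h t|); split; first exact: num_real.
move=> B hB y _ /=; apply: ltW; apply: le_lt_trans hB.
rewrite (bigD1 (cell_digits M y)) //= lerDl; exact: sumr_ge0.
Qed.

Lemma fourier_coefE M f i j :
  mu.-integrable (@I2 R) (EFin \o f) -> (i < 2 ^ M)%N -> (j < 2 ^ M)%N ->
  fourier_coef f i j =
  \sum_(t : M.-tuple (bool * bool))
    wal R (unzip1 t) i * wal R (unzip2 t) j * \int[mu]_(x in dyadic_cell t) f x.
Proof.
move=> fi iM jM; rewrite /fourier_coef.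
pose h (t : M.-tuple (bool * bool)) := wal R (unzip1 t) i * wal R (unzip2 t) j.
under eq_Rintegral => x _.
  rewrite (walsh_digits _ iM) (walsh_digits _ jM) -unzip1_dig -unzip2_dig -mulrA.
  rewrite -/(h (cell_digits M x)).
over.
rewrite (Rintegral_I2_dcell M) /=; last exact: integrable_step.
apply: eq_bigr => t _.
rewrite (@eq_Rintegral _ _ _ mu _ (fun x => f x * h t)) => [|x]; last first.
  by rewrite inE => -[_ <-].
rewrite RintegralZr; [by rewrite mulrC|exact: measurable_dcell|exact: integrable_dcell].
Qed.

Definition cell_avg M f (t : M.-tuple (bool * bool)) : R :=
  4 ^+ M * \int[mu]_(x in dyadic_cell t) f x.

(** The passage to finite digit sequences: for n <= 2^M only Walsh functions constant on the cells
    of level [M] occur, and their character property combines the values at x and y into the kernel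
    at the dyadic sum. *)
Lemma triang_fejerE M n f y :
  mu.-integrable (@I2 R) (EFin \o f) -> (n <= 2 ^ M)%N ->
  triang_fejer n f y = fejer_conv n (@cell_avg M f) (cell_digits M y).
Proof.
move=> fi nM; rewrite /triang_fejer /fejer_conv /cell_avg.
transitivity (n%:R^-1 * \sum_(k < n) \sum_(i < k) \sum_(j < k - i)
   \sum_(t : M.-tuple (bool * bool)) \int[mu]_(x in dyadic_cell t) f x *
     (wal R (unzip1 (xor_cell t (cell_digits M y))) i *
      wal R (unzip2 (xor_cell t (cell_digits M y))) j)).
  congr (_ * _); apply: eq_bigr => k _; apply: eq_bigr => i _; apply: eq_bigr => j _.
  have ? := ltn_ord k; have ? := ltn_ord i; have ? := ltn_ord j.
  have iM : (i < 2 ^ M)%N by lia.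
  have jM : (j < 2 ^ M)%N by lia.
  rewrite (fourier_coefE fi iM jM) !mulr_suml; apply: eq_bigr => t _.
  rewrite (walsh_digits _ iM) (walsh_digits _ jM) -unzip1_dig -unzip2_dig.
  have [-> _] := wal_xor R t (cell_digits M y) i; have [_ ->] := wal_xor R t (cell_digits M y) j.
  by ring.
rewrite [RHS]mulr_sumr.
under eq_bigr do under eq_bigr do rewrite exchange_big /=.
under eq_bigr do rewrite exchange_big /=.
rewrite exchange_big /= mulr_sumr; apply: eq_bigr => t _.
rewrite -!mulrA mulKf ?expf_neq0 ?pnatr_eq0 // mulrCA; congr (_ * _).
rewrite /fejer_ker mulr_sumr; apply: eq_bigr => k _.
rewrite tri_sumP mulr_sumr; apply: eq_bigr => i _.
by rewrite mulr_sumr.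
Qed.

End Cells.

(** * The maximal inequality *)

Section Maximal.
Variable R : realType.
Local Notation mu := (leb2 R).
Implicit Types (y : R * R) (f : R * R -> R).

Lemma sum_cell_avg M f : mu.-integrable (@I2 R) (EFin \o f) ->
  \sum_t `|@cell_avg R M f t| <= 4 ^+ M * \int[mu]_(x in @I2 R) `|f x|.
Proof.
move=> fi; rewrite (Rintegral_I2_dcell M); last first.
  by apply: integrable_norm.
rewrite mulr_sumr; apply: ler_sum => t _.
rewrite /cell_avg normrM ger0_norm ?exprn_ge0 // ler_wpM2l ?exprn_ge0 //.
apply: le_normr_Rintegral; [exact: measurable_dcell|exact: integrable_dcell].
Qed.

Definition maximal_set f lam : set (R * R) :=
  [set y | I2 y /\ exists n, (0 < n)%N /\ lam < `|triang_fejer n f y|].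

(** Level [M = n] serves each n, as n <= 2^n. The sets on the right are finite unions of cells,
    whence measurability. *)
Lemma maximal_set_bigcup f lam : mu.-integrable (@I2 R) (EFin \o f) ->
  maximal_set f lam = \bigcup_M [set y | I2 y /\ [exists n : 'I_(2 ^ M).+1,
    (0 < n)%N && (lam < `|fejer_conv n (@cell_avg R M f) (cell_digits M y)|)]].
Proof.
move=> fi; apply/seteqP; split => [y [yI [n [n0 ny]]]|y [M _ [yI /existsP[n /andP[n0 ny]]]]].
  exists n => //; split => //; apply/existsP.
  have nn : (n < (2 ^ n).+1)%N by rewrite ltnS ltnW // ltn_expl.
  by exists (Ordinal nn); rewrite n0 /= -triang_fejerE // -ltnS.
split => //; exists n; split => //; rewrite (triang_fejerE _ fi (M := M)) //.
by rewrite -ltnS ltn_ord.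
Qed.

Lemma measurable_maximal_set f lam : mu.-integrable (@I2 R) (EFin \o f) ->
  measurable (maximal_set f lam).
Proof.
move=> fi; rewrite maximal_set_bigcup //; apply: bigcupT_measurable => M.
exact: (measurable_cellwise (fun t => [exists n : 'I_(2 ^ M).+1,
    (0 < n)%N && (lam < `|fejer_conv n (@cell_avg R M f) t|)])).
Qed.

Lemma maximal_inequality : exists2 C : R, 0 <= C & forall f (lam : R),
  mu.-integrable (@I2 R) (EFin \o f) -> 0 < lam ->
  (mu (maximal_set f lam) <= (C * (\int[mu]_(x in @I2 R) `|f x|) / lam)%:E)%E.
Proof.
have [C C0 weak] := weak_type R; exists C => // f lam fi lam0.
rewrite maximal_set_bigcup //.
set E := fun M => [set y | I2 y /\ [exists n : 'I_(2 ^ M).+1,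
    (0 < n)%N && (lam < `|fejer_conv n (@cell_avg R M f) (cell_digits M y)|)]].
have mE M : measurable (E M).
  exact: (measurable_cellwise (fun t => [exists n : 'I_(2 ^ M).+1,
    (0 < n)%N && (lam < `|fejer_conv n (@cell_avg R M f) t|)])).
(* For n <= 2^M the levels [M] and [N] compute the same mean, so the sets increase and continuity
   from below transfers the finite inequality. *)
have ndE : nondecreasing_seq E.
  move=> M N MN; apply/subsetPset => y [yI /existsP[n /andP[n0 ny]]]; split => //.
  have nN : (n < (2 ^ N).+1)%N.
    by rewrite (leq_trans (ltn_ord n)) // ltnS leq_exp2l.
  apply/existsP; exists (Ordinal nN); rewrite n0 /=.
  have nM : (n <= 2 ^ M)%N by rewrite -ltnS ltn_ord.
  by rewrite -(triang_fejerE y fi (nN : n <= 2 ^ N)%N) (triang_fejerE y fi nM).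
have cvE := @nondecreasing_cvg_mu _ _ _ mu E mE (bigcupT_measurable E mE) ndE.
rewrite -(cvg_lim _ cvE) //; apply: lime_le.
  by apply/cvg_ex; exists (mu (\bigcup_M E M)).
near=> M => /=.
rewrite [X in (X <= _)%E](measure_cellwise R (fun t => [exists n : 'I_(2 ^ M).+1,
    (0 < n)%N && (lam < `|fejer_conv n (@cell_avg R M f) t|)])).
rewrite lee_fin ler_pdivlMr // mulrAC ler_pdivrMr ?exprn_gt0 // mulrC.
apply: le_trans (weak M (@cell_avg R M f) lam lam0) _; rewrite -(mulrA _ (Rintegral _ _ _)) ler_wpM2l //.
by rewrite [leRHS]mulrC sum_cell_avg.
Unshelve. all: by end_near. Qed.

End Maximal.

(** * Convergence for step functions, density, and the theorem *)

Section Steps.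
Variable R : realType.
Local Notation mu := (leb2 R).
Implicit Types (y : R * R) (f : R * R -> R) (h : seq (bool * bool) -> R).

Lemma take_dig A M y : (A <= M)%N -> take A (cell_digits M y) = cell_digits A y.
Proof.
by move=> AM; rewrite /= /mkseq -map_take take_iota (minn_idPl AM).
Qed.

Lemma integrable_stepfun A h : mu.-integrable (@I2 R) (EFin \o (fun y => h (cell_digits A y))).
Proof.
apply: measurable_bounded_integrable.
- exact: measurable_I2.
- by have := measure_I2 R => /= ->; rewrite ltry.
- exact: (measurable_step (fun t : A.-tuple _ => h t)).
exists (\sum_(t : A.-tuple (bool * bool)) `|h t|); split; first exact: num_real.
move=> B hB y _ /=; apply: ltW; apply: le_lt_trans hB.
rewrite (bigD1 (cell_digits A y)) //= lerDl; exact: sumr_ge0.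
Qed.

Lemma xor_digits0 k (u : seq (bool * bool)) : size u = k ->
  map xor_digit (zip u (nseq k (false, false))) = u.
Proof.
by elim: u k => [|[b c] u IH] [|k] //= [/IH ->]; rewrite /xor_digit /= !addbF.
Qed.

Lemma cell_avg_step A M h (t : M.-tuple (bool * bool)) : (A <= M)%N ->
  cell_avg (fun y => h (cell_digits A y)) t = h (take A t).
Proof.
move=> AM; rewrite /cell_avg.
rewrite (@eq_Rintegral _ _ _ mu _ (fun=> h (take A t))) => [|y]; last first.
  by rewrite inE => -[_ <-]; rewrite take_dig.
rewrite Rintegral_cst; last exact: measurable_dcell.
have -> : fine (mu (dyadic_cell t)) = (4 ^+ M)^-1 by rewrite measure_dcell.
by rewrite mulrCA mulfV ?mulr1 // expf_neq0 // pnatr_eq0.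
Qed.

Lemma cvg_fejer_ker (p : seq (bool * bool)) :
  (fun n => n%:R^-1 * fejer_ker R p n) @ \oo -->
  (if p == nseq (size p) (false, false) then 4 ^+ size p else 0 : R).
Proof.
have [N hN] := tri_sum_eventually R p.
have : tri_sum R p @ \oo --> (if p == nseq (size p) (false, false) then 4 ^+ size p else 0 : R).
  apply: cvg_near_cst; near=> n; apply: hN; near: n; exact: nbhs_infty_ge.
(* The kernel is a Cesaro mean of the eventually constant T_m; [arithmetic_mean] at n averages n + 1
   terms, hence the shift. *)
move/cesaro => H; rewrite -cvg_shiftS /=; apply: cvg_trans H.
apply: near_eq_cvg; near=> n.
by rewrite /arithmetic_mean /series /= big_mkord.
Unshelve. all: by end_near. Qed.

Lemma cvg_triang_fejer_step A h y : I2 y ->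
  (fun n => triang_fejer n (fun y => h (cell_digits A y)) y) @ \oo --> h (cell_digits A y).
Proof.
move=> yI.
pose s := map xor_digit \o zip (cell_digits A y).
have E n : triang_fejer n (fun y => h (cell_digits A y)) y = (4 ^+ A)^-1 *
    \sum_(p : A.-tuple (bool * bool)) h (s p) * (n%:R^-1 * fejer_ker R p n).
  (* Level A + n is fine enough both for the step function and for the Walsh functions that occur in
     the n-th mean. *)
  have nM : (n <= 2 ^ (A + n))%N.
    by rewrite (leq_trans (ltnW (ltn_expl n (isT : (1 < 2)%N)))) // leq_exp2l // leq_addl.
  rewrite (triang_fejerE y (integrable_stepfun A h) nM).
  rewrite /fejer_conv; under eq_bigr do rewrite cell_avg_step ?leq_addr //.
  by have := conv_step h n (cell_digits (A + n) y) (leq_addr n A); rewrite /fejer_conv take_dig ?leq_addr.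
rewrite (_ : (fun n => _) = (fun n => (4 ^+ A)^-1 *
    \sum_(p : A.-tuple (bool * bool)) h (s p) * (n%:R^-1 * fejer_ker R p n))); last first.
  by apply/funext => n; exact: E.
have -> : h (cell_digits A y) = (4 ^+ A)^-1 * \sum_(p : A.-tuple (bool * bool))
    h (s p) * (if val p == nseq (size p) (false, false) then 4 ^+ size p else 0).
  have z : size (nseq A (false, false)) == A by rewrite size_nseq.
  rewrite (bigD1 (Tuple z)) //= size_nseq eqxx big1 => [|p pz].
    rewrite addr0 mulrCA mulVf ?mulr1; last by rewrite expf_neq0 // pnatr_eq0.
    by rewrite /s /= xor_digits0 // size_tuple.
  by rewrite size_tuple -val_eqE /= in pz *; rewrite (negbTE pz) mulr0.
apply: cvgMl_tmp; apply: cvg_big => [|p _]; first exact: add_continuous.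
apply: cvgMl_tmp; exact: cvg_fejer_ker.
Qed.

End Steps.

(** * Approximation in L^1 by dyadic step functions *)

Section Density.
Variable R : realType.
Local Notation mu := (leb2 R).
Local Notation integrable f := (mu.-integrable (@I2 R) (EFin \o f)).
Implicit Types (y : R * R) (f g : R * R -> R) (h : seq (bool * bool) -> R).

Definition dist1 f g : R := \int[mu]_(x in @I2 R) `|f x - g x|.

Lemma integrable_sub f g : integrable f -> integrable g -> integrable (fun x => f x - g x).
Proof.
move=> fi gi; rewrite (_ : EFin \o _ = (EFin \o f) \- (EFin \o g))%E //.
by apply: integrableB fi gi; exact: measurable_I2.
Qed.

Lemma integrable_add f g : integrable f -> integrable g -> integrable (fun x => f x + g x).
Proof.
move=> fi gi; rewrite (_ : EFin \o _ = (EFin \o f) \+ (EFin \o g))%E //.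
by apply: integrableD fi gi; exact: measurable_I2.
Qed.

Lemma integrable_scale a f : integrable f -> integrable (fun x => a * f x).
Proof.
move=> fi; rewrite (_ : EFin \o _ = (fun x => a%:E * (EFin \o f) x))%E //.
by apply: integrableZl fi; exact: measurable_I2.
Qed.

Lemma integrable_dist f g : integrable f -> integrable g -> integrable (fun x => `|f x - g x|).
Proof. by move=> fi gi; apply: integrable_norm; exact: integrable_sub. Qed.

Lemma dist1_triangle f g k : integrable f -> integrable g -> integrable k ->
  dist1 f k <= dist1 f g + dist1 g k.
Proof.
move=> fi gi ki; rewrite /dist1 -RintegralD //; last 3 first.
- exact: measurable_I2.
- exact: integrable_dist.
- exact: integrable_dist.
apply: le_Rintegral => [|||x _].
- exact: measurable_I2.
- exact: integrable_dist.
- by apply: integrable_add; exact: integrable_dist.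
- exact: ler_distD.
Qed.

Lemma dist1D f1 f2 g1 g2 : integrable f1 -> integrable f2 ->
  integrable g1 -> integrable g2 ->
  dist1 (fun x => f1 x + f2 x) (fun x => g1 x + g2 x) <= dist1 f1 g1 + dist1 f2 g2.
Proof.
move=> ? ? ? ?; rewrite /dist1 -RintegralD //; last 3 first.
- exact: measurable_I2.
- exact: integrable_dist.
- exact: integrable_dist.
apply: le_Rintegral => [|||x _].
- exact: measurable_I2.
- by apply: integrable_dist; exact: integrable_add.
- by apply: integrable_add; exact: integrable_dist.
- by rewrite opprD addrACA ler_normD.
Qed.

Lemma dist1Z a f g : integrable f -> integrable g ->
  dist1 (fun x => a * f x) (fun x => a * g x) = `|a| * dist1 f g.
Proof.
move=> fi gi; rewrite /dist1 -RintegralZl; last 2 first.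
- exact: measurable_I2.
- exact: integrable_dist.
by apply: eq_Rintegral => x _; rewrite -mulrBr normrM.
Qed.

Definition approximable f := integrable f /\
  forall e : R, 0 < e -> exists A h, dist1 f (fun y => h (cell_digits A y)) <= e.

Lemma approximable_step A h : approximable (fun y => h (cell_digits A y)).
Proof.
split=> [|e e0]; first exact: integrable_stepfun.
exists A, h; rewrite /dist1 (@eq_Rintegral _ _ _ mu _ (fun=> 0)) => [|x _].
  by rewrite Rintegral_cst ?mul0r ?ltW //; exact: measurable_I2.
by rewrite subrr normr0.
Qed.

Lemma approximable_close f : integrable f ->
  (forall e : R, 0 < e -> exists g, approximable g /\ dist1 f g <= e) -> approximable f.
Proof.
move=> fi fg; split => // e e0; have e2 : 0 < e / 2 by rewrite divr_gt0.
have [g [[gi ga] fge]] := fg _ e2; have [A [h gh]] := ga _ e2.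
exists A, h; apply: le_trans (dist1_triangle fi gi (integrable_stepfun A h)) _.
by rewrite (splitr e) lerD.
Qed.

Lemma approximable_eq f g : (forall x, I2 x -> f x = g x) ->
  approximable f -> approximable g.
Proof.
move=> fg [fi fa]; split => [|e e0].
  apply: eq_integrable fi => [|x]; [exact: measurable_I2|rewrite inE => xI /=].
  by rewrite fg.
have [A [h fh]] := fa e e0; exists A, h; rewrite /dist1.
rewrite (@eq_Rintegral _ _ _ mu _ (fun x => `|f x - h (cell_digits A x)|)) // => x.
by rewrite inE => xI; rewrite fg.
Qed.

Lemma approximableD f g : approximable f -> approximable g ->
  approximable (fun x => f x + g x).
Proof.
move=> [fi fa] [gi ga]; split => [|e e0]; first exact: integrable_add.
have e2 : 0 < e / 2 by rewrite divr_gt0.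
have [A [h fh]] := fa _ e2; have [B [k gk]] := ga _ e2.
exists (A + B)%N, (fun u => h (take A u) + k (take B u)).
have -> : (fun y => h (take A (cell_digits (A + B) y)) + k (take B (cell_digits (A + B) y))) =
    (fun y => h (cell_digits A y) + k (cell_digits B y)).
  by apply/funext => y; rewrite !take_dig ?leq_addl ?leq_addr.
apply: le_trans (dist1D fi gi (integrable_stepfun A h) (integrable_stepfun B k)) _.
by rewrite (splitr e) lerD.
Qed.

Lemma approximableZ a f : approximable f -> approximable (fun x => a * f x).
Proof.
move=> [fi fa]; split => [|e e0]; first exact: integrable_scale.
have a1 : 0 < `|a| + 1 by rewrite ltr_wpDl.
have [A [h fh]] := fa _ (divr_gt0 e0 a1).
exists A, (fun u => a * h u).
rewrite (dist1Z a fi (integrable_stepfun A h)).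
rewrite ler_pdivlMr // in fh; apply: le_trans fh.
have d0 : 0 <= dist1 f (fun y => h (cell_digits A y)) by apply: Rintegral_ge0.
by rewrite mulrC ler_wpM2l // lerDl.
Qed.

Lemma approximable_sum (I : Type) (s : seq I) (F : I -> R * R -> R) :
  (forall i, approximable (F i)) -> approximable (fun x => \sum_(i <- s) F i x).
Proof.
move=> Fa; elim: s => [|i s IH].
  apply: approximable_eq (approximable_step 0 (fun=> 0)) => x _.
  by rewrite big_nil.
by apply: approximable_eq (approximableD (Fa i) IH) => x _; rewrite big_cons.
Qed.

Lemma approximable_lim (F : nat -> R * R -> R) f :
  (forall n, approximable (F n)) -> (forall n x, I2 x -> `|F n x| <= 1) ->
  measurable_fun (@I2 R) f ->
  (forall x, I2 x -> F ^~ x @ \oo --> f x) -> approximable f.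
Proof.
move=> Fa F1 mf Ff.
have int1 : integrable (fun=> 1 : R) by exact: (integrable_stepfun 0 (fun=> 1)).
have [] := @dominated_convergence _ _ _ mu _ (@measurable_I2 R) (fun n => EFin \o F n)
  (EFin \o f) (EFin \o (fun=> 1 : R)).
- by move=> n; have [/measurable_int] := Fa n.
- exact/measurable_EFinP.
- apply: aeW => x xI; apply: cvg_EFin; first exact: nearW.
  exact: Ff.
- exact: int1.
- by apply: aeW => x n xI /=; rewrite lee_fin F1.
move=> fi /= cv0 _; apply: approximable_close => // e e0.
move/fine_cvgP : cv0 => [_ /cvgrPdist_le /(_ e e0)] [N _ /(_ N (leqnn N))] /= H.
exists (F N); split => //; move: H; rewrite sub0r normrN.
rewrite ger0_norm; last by apply: fine_ge0; apply: integral_ge0.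
rewrite /dist1 /Rintegral => H; apply: le_trans H.
rewrite le_eqVlt; apply/orP; left; apply/eqP; congr fine.
by apply: eq_integral => x _ /=; rewrite distrC.
Qed.

Definition approx_set (S : set (R * R)) := measurable S /\ approximable (\1_S : _ -> R).

(* Sierpinski-Dynkin for one coordinate at a time: p is fst, snd or the identity. *)
Lemma approx_set_preimage (T : Type) (G : set (set T)) (p : R * R -> T) (S : set (R * R)) :
  setI_closed G -> approx_set S ->
  (forall A, G A -> approx_set (p @^-1` A `&` S)) ->
  forall A, <<s G>> A -> approx_set (p @^-1` A `&` S).
Proof.
move=> GI aS aG; apply: (@lambda_system_subset _ G GI setT) => //; split => //.
- by rewrite /= preimage_setT setTI.
- move=> A B BA [mA aA] [mB aB].
  have E : p @^-1` (A `\` B) `&` S = (p @^-1` A `&` S) `\` (p @^-1` B `&` S).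
    apply/seteqP; split => x /=; first by move=> [[? ?] ?]; split => // -[].
    by move=> [[? ?] H]; split => //; split => // pB; apply: H.
  split; rewrite E; first exact: measurableD.
  apply: approximable_eq (approximableD aA (approximableZ (-1) aB)) => x _.
  rewrite indicE /= -/(\1_(p @^-1` A `&` S) x) !indicE in_setD.
  have : x \in p @^-1` B `&` S -> x \in p @^-1` A `&` S.
    by rewrite !inE => -[? ?]; split => //; exact: BA.
  by case: (x \in p @^-1` A `&` S) (x \in p @^-1` B `&` S) => [] [] //= H;
    rewrite ?mulN1r ?subrr ?subr0 ?oppr0 ?addr0 //; have := H isT.
- move=> F ndF aF.
  have E : p @^-1` (\bigcup_i F i) `&` S = \bigcup_i (p @^-1` F i `&` S).
    by rewrite preimage_bigcup setI_bigcupl.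
  have mE : measurable (\bigcup_i (p @^-1` F i `&` S)).
    by apply: bigcupT_measurable => i; have [] := aF i.
  split; rewrite E //.
  apply: (@approximable_lim (fun n => \1_(p @^-1` F n `&` S))).
  + by move=> n; have [] := aF n.
  + by move=> n x _; rewrite indicE; case: (_ \in _); rewrite ?normr1 ?normr0.
  + by apply: measurable_funTS; exact: measurable_indic.
  + move=> x _; apply: cvg_near_cst; rewrite indicE.
    have [/set_mem [k _ [Fk Sx]]|xF] := boolP (x \in _); last first.
      near=> n; rewrite indicE; case: (boolP (x \in _)) => // /set_mem xn.
      by move: xF; rewrite notin_setE => -[]; exists n.
    near=> n; rewrite indicE mem_set //=; split => //.
    have : (F k `<=` F n) by apply/subsetPset/ndF; near: n; exact: nbhs_infty_ge.
    exact.
Unshelve. all: by end_near. Qed.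

End Density.

Section Density.
Variable R : realType.
Local Notation mu := (leb2 R).
Local Notation integrable f := (mu.-integrable (@I2 R) (EFin \o f)).
Implicit Types (y : R * R) (f g : R * R -> R) (h : seq (bool * bool) -> R).

(** The left ends approach x from below, so the strict comparison stabilizes at every x, even at x =
    a. This is why open rays to the right serve as generators. *)
Lemma lower_digits_gt (a x : R) : 0 <= x < 1 ->
  \forall n \near \oo, (a < lower R (digits n x)) = (a < x).
Proof.
move=> x01; have lowx n : lower R (digits n x) <= x < lower R (digits n x) + (2 ^+ n)^-1.
  by rewrite -digits_eq ?size_mkseq.
have [ax|xa] := ltP a x; last first.
  by near=> n; apply/negbTE; rewrite -leNgt (le_trans _ xa) //; case/andP: (lowx n).
have c0 : (fun n => (2^-1 : R) ^+ n) @ \oo --> (0 : R).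
  by apply: cvg_expr; rewrite ger0_norm; lra.
have /cvgrPdist_lt /(_ (x - a)) := c0; rewrite subr_gt0 => /(_ ax) near0.
near=> n; have /andP[l1 l2] := lowx n.
have : `|0 - (2^-1 : R) ^+ n| < x - a by near: n.
rewrite sub0r normrN ger0_norm ?exprn_ge0 ?invr_ge0 // exprVn; lra.
Unshelve. all: by end_near. Qed.

Lemma approx_set_rays (a b : R) :
  approx_set ((fst : R * R -> R) @^-1` `]a, +oo[ `&` (snd : R * R -> R) @^-1` `]b, +oo[).
Proof.
set S := _ `&` _; have mS : measurable S.
  rewrite (_ : S = `]a, +oo[ `*` `]b, +oo[) //.
  by apply: measurableX; exact: measurable_itv.
have SE y : \1_S y = ((a < y.1) && (b < y.2))%:R :> R.
  rewrite indicE; congr ((nat_of_bool _)%:R); apply/idP/idP.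
    by rewrite inE /S /= !in_itv /= !andbT => -[-> ->].
  by move=> /andP[? ?]; rewrite inE /S /= !in_itv /= !andbT.
split => //; pose h (u : seq (bool * bool)) : R :=
  ((a < lower R (unzip1 u)) && (b < lower R (unzip2 u)))%:R.
apply: (@approximable_lim R (fun n y => h (cell_digits n y))).
- by move=> n; exact: approximable_step.
- by move=> n x _; rewrite /h; case: (_ && _); rewrite ?normr1 ?normr0.
- by apply: measurable_funTS; exact: measurable_indic.
move=> y [/= y1 y2]; rewrite !in_itv /= in y1 y2.
apply: cvg_near_cst; have n1 := lower_digits_gt a y1; have n2 := lower_digits_gt b y2.
near=> n; rewrite SE /h unzip1_dig unzip2_dig; congr ((nat_of_bool (_ && _))%:R).
- by near: n.
- by near: n.
Unshelve. all: by end_near. Qed.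

Lemma approx_set_eq (S T : set (R * R)) : measurable T ->
  (forall y, I2 y -> S y <-> T y) -> approx_set S -> approx_set T.
Proof.
move=> mT ST [_ aS]; split => //; apply: approximable_eq aS => y yI.
rewrite !indicE; congr ((nat_of_bool _)%:R); apply/idP/idP; rewrite !inE;
  by have [] := ST y yI; auto.
Qed.

Lemma measurable_rays : @measurable _ (measurableTypeR R) = <<s (@RGenOInfty.G R) >>.
Proof. exact: (RGenOInfty.measurableE R). Qed.

Lemma setI_closed_rays : setI_closed (@RGenOInfty.G R).
Proof.
move=> _ _ [a ->] [b ->]; exists (Num.max a b); apply/seteqP; split => x /=.
  by rewrite !in_itv /= !andbT gt_max => -[-> ->].
by rewrite !in_itv /= !andbT gt_max => /andP[].
Qed.

Lemma I2_gt y : I2 y -> (-1 < y.1) /\ (-1 < y.2).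
Proof. by move=> [/=]; rewrite !in_itv /= => /andP[? _] /andP[? _]; split; lra. Qed.

Lemma approx_setX (A B : set R) : measurable A -> measurable B -> approx_set (A `*` B).
Proof.
move=> mA mB.
have mfst C : measurable C -> measurable ((fst : R * R -> R) @^-1` C).
  by move=> mC; rewrite -[_ @^-1` _]setTI; apply: measurable_fst.
have msnd C : measurable C -> measurable ((snd : R * R -> R) @^-1` C).
  by move=> mC; rewrite -[_ @^-1` _]setTI; apply: measurable_snd.
have rays b : forall C, measurable C ->
    approx_set ((fst : R * R -> R) @^-1` C `&` (snd : R * R -> R) @^-1` `]b, +oo[).
  move=> C mC; apply: (approx_set_preimage setI_closed_rays).
  (* The ray from -1 stands for the whole line, since it contains [0, 1[. *)
  - apply: approx_set_eq (approx_set_rays (-1) b); first by apply: msnd; exact: measurable_itv.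
    move=> y /I2_gt[y1 _] /=; rewrite !in_itv /= !andbT; split; first by case.
    by move=> ?; split.
  - by move=> _ [a ->]; exact: approx_set_rays.
  - by rewrite -measurable_rays.
rewrite (_ : A `*` B = (snd : R * R -> R) @^-1` B `&` (fst : R * R -> R) @^-1` A); last first.
  by rewrite setIC.
apply: (approx_set_preimage setI_closed_rays).
- apply: approx_set_eq (rays (-1) A mA); first exact: mfst.
  move=> y /I2_gt[_ y2] /=; rewrite !in_itv /= !andbT; split; first by case.
  by move=> ?; split.
- by move=> _ [b ->]; rewrite setIC; exact: rays.
- by rewrite -measurable_rays.
Qed.

Lemma approx_set_measurable (S : set (R * R)) : measurable S -> approx_set S.
Proof.
rewrite measurable_prod_measurableType => mS.
rewrite -[S]setIT -[S](preimage_id).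
apply: (@approx_set_preimage R _ _ id setT _ _ _ S mS).
- move=> _ _ [A mA [B mB <-]] [A' mA' [B' mB' <-]].
  exists (A `&` A'); first exact: measurableI.
  by exists (B `&` B'); [exact: measurableI|rewrite setXI].
- by rewrite -setXTT; exact: approx_setX.
- by move=> _ [A mA [B mB <-]]; rewrite setIT; exact: approx_setX.
Qed.

Lemma approximable_sfun (g : {sfun (measurableTypeR R * measurableTypeR R)%type >-> R}) :
  approximable (g : R * R -> R).
Proof.
have ga : approximable (fun x : R * R => \sum_(r <- finmap.enum_fset (fset_set (range g))) r * \1_(g @^-1` [set r]) x).
  apply: approximable_sum => r; apply: approximableZ.
  have mg : measurable (g @^-1` [set r]) by rewrite -[_ @^-1` _]setTI; apply: measurable_funPT.
  by have [] := approx_set_measurable mg.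
by apply: approximable_eq ga => x _; rewrite [RHS]fimfunE fsbig_finite.
Qed.

Lemma approximable_integrable f : integrable f -> approximable f.
Proof.
move=> fi; have [g_ [gi _ gf]] := @approximation_sfun_integrable _ _ _ mu _ (@measurable_I2 R) _ fi.
apply: approximable_close => // e e0.
move/fine_cvgP : gf => [_ /cvgrPdist_le /(_ e e0)] [N _ /(_ N (leqnn N))] /= H.
exists (g_ N); split; first exact: approximable_sfun.
by move: H; rewrite sub0r normrN ger0_norm // fine_ge0 // integral_ge0.
Qed.

End Density.

(** * From the maximal inequality to almost everywhere convergence *)

Section Convergence.
Variable R : realType.
Local Notation mu := (leb2 R).
Local Notation integrable f := (mu.-integrable (@I2 R) (EFin \o f)).
Implicit Types (y : R * R) (f g : R * R -> R) (h : seq (bool * bool) -> R).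

Lemma triang_fejer_rect n f y :
  triang_fejer n f y = n%:R^-1 * \sum_(k < n) rect_sum k (n - k) f y.
Proof.
rewrite /triang_fejer /triang_sum /rect_sum; congr (_ * _).
pose a i j : R := fourier_coef f i j * walsh i y.1 * walsh j y.2.
have swap (F : nat -> nat -> R) : \sum_(k < n) \sum_(i < k) F k i =
    \sum_(i < n) \sum_(i.+1 <= k < n) F k i.
  under eq_bigr => k _ do rewrite (big_ord_widen n (F k) (ltnW (ltn_ord k))).
  rewrite (exchange_big_dep xpredT) //=; apply: eq_bigr => i _.
  by rewrite big_geq_mkord.
rewrite (swap (fun k i => \sum_(j < k - i) a i j)).
rewrite (swap (fun k i => \sum_(j < n - k) a i j)).
(* For fixed i, reversing the range i < k < n turns the inner length k - i into n - k. *)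
apply: eq_bigr => i _; rewrite big_nat_rev /= !big_nat; apply: eq_bigr => k /andP[ik kn].
by have -> : (i.+1 + n - k.+1 - i = n - k)%N by lia.
Qed.

Lemma triang_fejerB n f g y : integrable f -> integrable g ->
  triang_fejer n (fun x => f x - g x) y = triang_fejer n f y - triang_fejer n g y.
Proof.
move=> fi gi; have nn : (n <= 2 ^ n)%N by rewrite ltnW // ltn_expl.
rewrite !(triang_fejerE y _ nn) //; last exact: integrable_sub.
rewrite /fejer_conv -mulrBr -sumrB; congr (_ * _); apply: eq_bigr => t _.
rewrite -mulrBl; congr (_ * _); rewrite /cell_avg -mulrBr -RintegralB //.
- exact: measurable_dcell.
- exact: integrable_dcell.
- exact: integrable_dcell.
Qed.

Definition bad_set f (e : R) : set (R * R) :=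
  [set y | I2 y /\ ~ \forall n \near \oo, `|f y - triang_fejer n f y| <= e].

(** With a step function g at L^1 distance at most d, the difference splits into f - g, g - sigma_n
    g and sigma_n (g - f), each allowed e / 3. Chebyshev's inequality covers the first failure and
    the maximal inequality the third, whence 3 (C + 1); the second part tends to 0 everywhere on the
    square. *)
Lemma bad_set_cover : exists2 C : R, 0 <= C & forall f (e d : R),
  integrable f -> 0 < e -> 0 < d ->
  exists2 U, measurable U /\ bad_set f e `<=` U & (mu U <= (C * d / e)%:E)%E.
Proof.
have [C C0 maxC] := maximal_inequality R.
exists (3 * (C + 1)) => [|f e d fi e0 d0]; first by rewrite mulr_ge0 // addr_ge0.
have [_ /(_ d d0) [A [h fh]]] := approximable_integrable fi.
set g := (fun y => h (cell_digits A y)) in fh *.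
have gi : integrable g := integrable_stepfun A h.
have fgi := integrable_sub fi gi.
have e3 : 0 < e / 3 by rewrite divr_gt0.
pose U1 := maximal_set (fun x => f x - g x) (e / 3).
pose U2 := @I2 R `&` [set x | ((e / 3)%:E <= `|(f x - g x)%:E|)%E].
have mfg : measurable_fun (@I2 R) (EFin \o (fun x => f x - g x)) := measurable_int _ fgi.
have mU1 : measurable U1 by exact: measurable_maximal_set.
have mU2 : measurable U2.
  apply: emeasurable_fun_c_infty; first exact: measurable_I2.
  exact: measurableT_comp.
exists (U1 `|` U2); first split; first exact: measurableU.
  move=> y [yI nbad]; apply: contrapT => yU; apply: nbad.
  have fg : `|f y - g y| < e / 3.
    rewrite ltNge; apply/negP => H; apply: yU; right; split => //=.
  have sfg n : (0 < n)%N -> `|triang_fejer n f y - triang_fejer n g y| <= e / 3.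
    move=> n0; rewrite -triang_fejerB // leNgt; apply/negP => H.
    by apply: yU; left; split => //; exists n.
  have /cvgrPdist_le /(_ _ e3) gn := @cvg_triang_fejer_step R A h y yI.
  near=> n.
  have n0 : (0 < n)%N by near: n; exact: nbhs_infty_gt.
  have gn' : `|g y - triang_fejer n g y| <= e / 3 by near: n; exact: gn.
  have := sfg n n0; move: fg gn'; rewrite !ltr_norml !ler_norml.
  by move=> /andP[? ?] /andP[? ?] /andP[? ?]; apply/andP; split; lra.
have dd : \int[mu]_(x in @I2 R) `|f x - g x| <= d := fh.
have U12 : (mu (U1 `|` U2) <= mu U1 + mu U2)%E by apply: measureU2.
apply: le_trans U12 _.
have -> : 3 * (C + 1) * d / e = C * d / (e / 3) + d / (e / 3).
  by field; rewrite gt_eqF.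
rewrite EFinD; apply: leeD.
  apply: le_trans (maxC _ _ fgi e3) _; rewrite lee_fin.
  by apply: ler_wpM2r; [rewrite invr_ge0 ltW|exact: ler_wpM2l].
have := le_integral_abse mu (@measurable_I2 R) mfg e3.
rewrite -/U2 => H.
pose k x := f x - g x.
have fin : (\int[mu]_(x in @I2 R) `|(EFin \o k) x|)%E =
    (\int[mu]_(x in @I2 R) `|f x - g x|)%:E.
  rewrite /Rintegral fineK //.
  apply: (@integrable_fin_num _ _ _ mu _ (@measurable_I2 R)).
  exact: integrable_dist.
rewrite fin in H.
rewrite EFinM lee_pdivlMr // muleC; apply: le_trans H _.
by rewrite lee_fin.
Unshelve. all: by end_near. Qed.

Lemma bad_set_negligible f (e : R) : integrable f -> 0 < e -> mu.-negligible (bad_set f e).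
Proof.
move=> fi e0; have [C C0 cover] := bad_set_cover.
have d0 k : 0 < k.+1%:R^-1 :> R by rewrite invr_gt0 ltr0n.
have /choice [U HU] : forall k, exists U, [/\ measurable U, bad_set f e `<=` U &
    (mu U <= (C / e * k.+1%:R^-1)%:E)%E].
  move=> k; have [U [mU sU] leU] := cover f e _ fi e0 (d0 k).
  by exists U; split => //; rewrite mulrAC.
exists (\bigcap_k U k).
have mU : measurable (\bigcap_k U k).
  by apply: bigcapT_measurable => k; have [] := HU k.
split; first exact: mU.
  apply/eqP; rewrite eq_le measure_ge0 andbT; apply/lee_addgt0Pr => r r0.
  rewrite add0e.
  (* Then k + 1 > C / (e r), so the cover obtained with d = 1 / (k + 1) has measure at most r. *)
  pose k := Num.truncn (r^-1 * (C / e)).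
  have [mUk _ leU] := HU k.
  apply: (@le_trans _ _ (mu (U k))).
    by apply: le_measure; rewrite ?inE; [exact: mU|exact: mUk|exact: bigcap_inf].
  apply: le_trans leU _; rewrite lee_fin ler_pdivrMr ?ltr0n // -ler_pdivrMl //.
  exact/ltW/truncnS_gt.
by move=> y yb k _; have [_ sU _] := HU k; exact: sU.
Qed.

(** The precisions 1 / (k + 1) suffice, so the exceptional set lies in a countable union of
    negligible sets. *)
Lemma ae_cvg_triang_fejer f : integrable f ->
  {ae mu, forall y, I2 y -> (fun n => triang_fejer n f y) @ \oo --> f y}.
Proof.
move=> fi; have neg k : mu.-negligible (bad_set f k.+1%:R^-1).
  by apply: bad_set_negligible => //; rewrite invr_gt0 ltr0n.
apply: negligibleS (negligible_bigcup neg) => y /= /not_implyP [yI ncvg].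
apply: contrapT => H; apply: ncvg; apply/cvgrPdist_le => e e0.
have e1 : 0 <= e^-1 by rewrite invr_ge0 ltW.
have ke : (Num.truncn e^-1).+1%:R^-1 <= e.
  rewrite -[leRHS]invrK lef_pV2 ?posrE ?invr_gt0 ?ltr0n //.
  exact/ltW/truncnS_gt.
have : \forall n \near \oo, `|f y - triang_fejer n f y| <= (Num.truncn e^-1).+1%:R^-1.
  by apply: contrapT => bad; apply: H; exists (Num.truncn e^-1).
by apply: filterS => n /le_trans; apply.
Qed.

End Convergence.

Theorem theorem1p1 (R : realType) (f : R * R -> R)
  (f_L1 : (leb2 R).-integrable (@I2 R) (EFin \o f)) :
  (forall (n : nat) (y : R * R), (1 <= n)%N -> I2 y ->
     triang_fejer n f y = n%:R^-1 * \sum_(k < n) rect_sum k (n - k) f y) /\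
  {ae leb2 R, forall y : R * R,
     I2 y -> (fun n : nat => triang_fejer n f y) @ \oo --> f y}.
Proof.
split=> [n y _ _|]; first exact: triang_fejer_rect.
exact: ae_cvg_triang_fejer.
Qed.
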